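(* In the setting described in the context, the limit $u\in H^1([0,T])$ (whose weak derivative $\dot u$ represents the limit of $\partial_t\rho_\varepsilon$) satisfies $$\int_0^T\Big(\tfrac12g_u(\dot u,\dot u)+DE(u)\dot u\Big)dt\ \le\ \int_0^T\Big(\tfrac12g_u(v,v)+DE(u)v\Big)dt$$ for all $v\in L^2([0,T])$.
   Context: **Potential.** $H:\mathbb R\to\mathbb R$ is a smooth, nonnegative, even function with $xH'(x)<0$ for $0<|x|<1$, $xH'(x)>0$ for $|x|>1$, $H(\pm1)=H'(\pm1)=H'(0)=0$, $H(0)=H(\pm2)=1$, $H''(0)<0<H''(\pm1)$. **Constants and invariant measure.** The parameter $\varepsilon$ ranges over $(0,\varepsilon_0]$, where $\varepsilon_0>0$ is such that $e^{-H/\varepsilon^2}$ is integrable for these $\varepsilon$. Put $$\tau_\varepsilon:=\varepsilon^{-2}e^{-1/\varepsilon^2},\quad k:=\pi^{-1}\sqrt{|H''(0)|\,H''(1)},\quad Z_\varepsilon:=\int_{\mathbb R}e^{-H(y)/\varepsilon^2}dy,\quad \gamma_\varepsilon(x):=Z_\varepsilon^{-1}e^{-H(x)/\varepsilon^2}.$$ **Solutions.** $\rho_\varepsilon:[0,\infty)\times\mathbb R\to[0,\infty)$ solves $\tau_\varepsilon\partial_t\rho_\varepsilon=\partial_x(\partial_x\rho_\varepsilon+\varepsilon^{-2}\rho_\varepsilon H')$ with initial datum $\rho^0_\varepsilon$; equivalently $u_\varepsilon:=\rho_\varepsilon/\gamma_\varepsilon$ solves $\tau_\varepsilon\gamma_\varepsilon\partial_tu_\varepsilon=\partial_x(\gamma_\varepsilon\partial_xu_\varepsilon)$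 with initial datum $u^0_\varepsilon=\rho^0_\varepsilon/\gamma_\varepsilon$. A solution is understood to have $\int_{\mathbb R}\rho_\varepsilon(t,x)\,dx=1$ for all $t$, $u_\varepsilon$ smooth for $t>0$ and attaining $u^0_\varepsilon$ continuously in $L^2(\gamma_\varepsilon dx)$ as $t\to0$, and to satisfy for all $t\ge0$ $$\int_{\mathbb R}\gamma_\varepsilon|u_\varepsilon|^2dx+\frac2{\tau_\varepsilon}\int_0^t\!\!\int_{\mathbb R}\gamma_\varepsilon|\partial_xu_\varepsilon|^2dx\,ds=\int_{\mathbb R}\gamma_\varepsilon|u^0_\varepsilon|^2dx,$$ $$\frac1{2\tau_\varepsilon}\int_{\mathbb R}\gamma_\varepsilon|\partial_xu_\varepsilon|^2dx+\int_0^t\!\!\int_{\mathbb R}\frac{|\partial_t\rho_\varepsilon|^2}{\gamma_\varepsilon}dx\,ds=\frac1{2\tau_\varepsilon}\int_{\mathbb R}\gamma_\varepsilon|\partial_xu_\varepsilon^0|^2dx,$$ and the maximum-principle bound $\inf_{t\ge0,\,x\in\mathbb R,\,\varepsilon}u_\varepsilon(t,x)>0$. **Initial data.** The $\rho_\varepsilon^0$ are probability measures (with densities) converging weakly$\star$ as $\varepsilon\to0$ to a probability measure $\rho^0$, with $\int_{\mathbb R}\gamma_\varepsilon|u_\varepsilon^0|^2dx+\int_{\mathbb R}\gamma_\varepsilon|\partial_xu_\varepsilon^0|^2/\tau_\varepsilon\,dx\le C$ and $u_\varepsilon^0\ge c>0$ on $\mathbb R$, where $C,c$ do not depend on $\varepsilon$.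 **Intervals.** Fix $0<T<\infty$ and $0<\alpha<1$; $J^\pm_\varepsilon:=(\pm1-\varepsilon^\alpha,\pm1+\varepsilon^\alpha)$, $\bar J_\varepsilon:=\mathbb R\setminus(J^-_\varepsilon\cup J^+_\varepsilon)$. **Subsequence and limit.** A sequence $\varepsilon\to0$ and a function $u\in H^1([0,T])$ are fixed such that along the sequence: (i) for each $t\in[0,T]$, $\rho_\varepsilon(t,\cdot)$ converges weakly$\star$ to $\frac12(u(t)\delta_{+1}+(2-u(t))\delta_{-1})$, and, uniformly in $t\in[0,T]$, $\int_{J^\pm_\varepsilon}\rho_\varepsilon dx\to\frac12\pm\frac12(u-1)$ and $\int_{\bar J_\varepsilon}\rho_\varepsilon dx\to0$; (ii) $\partial_t\rho_\varepsilon$ converges weakly$\star$ as measures on $[0,T]\times\mathbb R$ to $\frac12(\dot u\delta_{+1}-\dot u\delta_{-1})$, with $\int_{J^\pm_\varepsilon}\partial_t\rho_\varepsilon dx\rightharpoonup\pm\frac12\dot u$ weakly in $L^2([0,T])$ and $\int_{\bar J_\varepsilon}|\partial_t\rho_\varepsilon|dx\to0$ strongly in $L^2([0,T])$; (iii) there is $c_*\in(0,2)$ with $c_*\le u(t)\le2-c_*$ for all $t\in[0,T]$. (Such a sequence and $u$ always exist in this setting.) **Limit gradient structure.** For $u\in(0,2)$ and $v\in\mathbb R$: $$g_u(v,v):=\frac{v^2\ln(u/(2-u))}{2k(u-1)}\quad(\text{with }g_1(v,v)=v^2/k),\qquad E(u):=\tfrac12\big(u\ln u+(2-u)\ln(2-u)\big),\qquad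 DE(u)v=\tfrac12\,v\,\ln\frac{u}{2-u}.$$ *)

(* Defs.v *)
From mathcomp Require Import all_boot all_order all_algebra.
From mathcomp Require Import ring lra.
From mathcomp Require Import all_classical all_reals all_analysis.

Set Implicit Arguments.
Unset Strict Implicit.
Unset Printing Implicit Defensive.

Import Order.TTheory GRing.Theory Num.Theory.
Import numFieldNormedType.Exports.

Local Open Scope ring_scope.
Local Open Scope classical_set_scope.

Notation leb := lebesgue_measure.

Definition smooth (R : realType) (f : R -> R) : Prop :=
  forall n x, derivable (derive1n n f) x 1.

(* Partial derivatives of a function of (t, x). *)
Definition d_t (R : realType) (f : R -> R -> R) (t x : R) : R :=
  derive1 (fun s => f s x) t.
Definition d_x (R : realType) (f : R -> R -> R) (t x : R) : R :=
  derive1 (f t) x.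

Fixpoint partials (R : realType) (w : seq bool) (f : R -> R -> R) :
    R -> R -> R :=
  if w is b :: w' then partials w' (if b then d_t f else d_x f) else f.

(* C^oo on (0, +oo) x R: the iterated partial derivatives, in every order of
   differentiation, exist and are jointly continuous. *)
Definition smooth_pos (R : realType) (f : R -> R -> R) : Prop :=
  forall (w : seq bool) (t x : R), 0 < t ->
  [/\ derivable (fun s => partials w f s x) t 1,
      derivable (partials w f t) x 1 &
      {for (t, x), continuous (fun p : R * R => partials w f p.1 p.2)}].

Definition L2 (R : realType) (D : set R) (f : R -> R) : Prop :=
  measurable_fun D f /\
  (\int[leb]_(x in D) ((f x) ^+ 2)%:E < +oo)%E.

Definition weakL2_cvg (R : realType) (D : set R) (f_ : nat -> R -> R)
    (f : R -> R) : Prop :=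
  [/\ forall n, L2 D (f_ n), L2 D f &
      forall g, L2 D g ->
        \int[leb]_(x in D) (f_ n x * g x) @[n --> \oo]
        --> \int[leb]_(x in D) (f x * g x)].

Definition test_function (R : realType) (D : set R) (phi : R -> R) : Prop :=
  smooth phi /\
  exists K : set R, [/\ compact K, K `<=` D & forall x, ~ K x -> phi x = 0].

Definition weak_derivative (R : realType) (D : set R) (f df : R -> R) : Prop :=
  [/\ locally_integrable D f, locally_integrable D df &
      forall phi, test_function D phi ->
        \int[leb]_(x in D) (f x * derive1 phi x) =
        - \int[leb]_(x in D) (df x * phi x)].

(* u is the continuous representative of its class in H^1(0, T), so that the
   values u(t) make sense for every t in [0, T]. *)
Definition H1 (R : realType) (T : R) (u du : R -> R) : Prop :=
  [/\ {within `[0, T], continuous u}, L2 `[0, T] u, L2 `[0, T] du &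
      weak_derivative `]0, T[ u du].

(* C_0(R), the predual of the finite measures on R. *)
Definition C0 (R : realType) (phi : R -> R) : Prop :=
  [/\ continuous phi, phi x @[x --> +oo] --> 0 & phi x @[x --> -oo] --> 0].

(* C_0([0, T] x R) *)
Definition C0_strip (R : realType) (T : R) (phi : R * R -> R) : Prop :=
  {within `[0, T] `*` [set: R], continuous phi} /\
  forall d : R, 0 < d -> exists M : R,
    forall t x, t \in `[0, T] -> M <= `|x| -> `|phi (t, x)| < d.

Record potential (R : realType) (H : R -> R) : Prop := Potential {
  pot_smooth : smooth H ;
  pot_ge0 : forall x, 0 <= H x ;
  pot_even : forall x, H (- x) = H x ;
  pot_in : forall x, 0 < `|x| < 1 -> x * derive1 H x < 0 ;
  pot_out : forall x, 1 < `|x| -> 0 < x * derive1 H x ;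
  pot_wells : H 1 = 0 /\ H (-1) = 0 ;
  pot_crit : [/\ derive1 H 1 = 0, derive1 H (-1) = 0 & derive1 H 0 = 0] ;
  pot_one : [/\ H 0 = 1, H 2 = 1 & H (-2) = 1] ;
  pot_curv : [/\ derive1n 2 H 0 < 0, 0 < derive1n 2 H 1 & 0 < derive1n 2 H (-1)]
}.

Section Quantities.
Context {R : realType}.
Implicit Types (H : R -> R) (eps alpha : R).

Definition boltzmann H eps (x : R) : R := expR (- (H x / eps ^+ 2)).
Definition tau eps : R := eps ^- 2 * expR (- eps ^- 2).
Definition kconst H : R := pi^-1 * Num.sqrt (`|derive1n 2 H 0| * derive1n 2 H 1).
Definition Z H eps : R := \int[leb]_y boltzmann H eps y.
Definition gamma H eps (x : R) : R := (Z H eps)^-1 * boltzmann H eps x.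

(* u = rho / gamma, for a function of x and for a function of (t, x) *)
Definition dens H eps (r : R -> R) (x : R) : R := r x / gamma H eps x.
Definition densT H eps (r : R -> R -> R) (t : R) : R -> R :=
  dens H eps (r t).

Definition J alpha (s : R) eps : set R :=
  `]s - eps `^ alpha, s + eps `^ alpha[%classic.
Definition Jbar alpha eps : set R := ~` (J alpha (-1) eps `|` J alpha 1 eps).

Definition gmet H (u v w : R) : R :=
  if u == 1 then v * w / kconst H
  else v * w * ln (u / (2 - u)) / (2 * kconst H * (u - 1)).

Definition E (u : R) : R := 2^-1 * (u * ln u + (2 - u) * ln (2 - u)).
Definition DE (u v : R) : R := 2^-1 * v * ln (u / (2 - u)).

Lemma is_derive_E (u : R) : 0 < u < 2 -> is_derive u 1 E (DE u 1).
Proof.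
move=> /andP[u0 u2].
have v0 : 0 < 2 - u by rewrite subr_gt0.
have d2 : is_derive u 1 (fun x : R => 2 - x) (-1).
  have := is_deriveB (is_derive_cst (2 : R) u 1) (is_derive_id u 1).
  by rewrite sub0r.
have dl : is_derive u 1 (fun x : R => ln (2 - x)) (- (2 - u)^-1).
  have := @is_derive1_comp _ (@ln R) (fun x => 2 - x) u _ _ (is_derive1_ln v0) d2.
  by rewrite mulrN1.
have du : is_derive u 1 (@ln R) u^-1 by exact: is_derive1_ln.
rewrite /E; apply: is_derive_eq.
rewrite /DE lnM ?posrE ?invr_gt0// lnV ?posrE// /GRing.scale/=.
by field; rewrite !gt_eqF.
Qed.

End Quantities.

(* Admissible initial data for one value of eps; du0 is the weak derivative of
   u0 = rho0 / gamma. *)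
Record initial_data (R : realType) (H : R -> R) (C c eps : R)
    (rho0 du0 : R -> R) : Prop := InitialData {
  ini_measurable : measurable_fun [set: R] rho0 ;
  ini_ge0 : forall x, 0 <= rho0 x ;
  ini_mass : (\int[leb]_x (rho0 x)%:E = 1)%E ;
  ini_deriv : weak_derivative [set: R] (dens H eps rho0) du0 ;
  ini_bound :
    (\int[leb]_x (gamma H eps x * dens H eps rho0 x ^+ 2)%:E
     + \int[leb]_x (gamma H eps x * du0 x ^+ 2 / tau eps)%:E <= C%:E)%E ;
  ini_lower : forall x, c <= dens H eps rho0 x
}.

(* In the identities, the x-derivative of u at time 0 is the weak derivative
   du0; d_t rho and d_x u are classical derivatives, used at times t > 0 only
   (up to the null set {0} of the time integrals). *)
Record solution (R : realType) (H : R -> R) (eps : R) (rho0 du0 : R -> R)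
    (rho : R -> R -> R) : Prop := Solution {
  sol_init : forall x, rho 0 x = rho0 x ;
  sol_ge0 : forall t x, 0 <= t -> 0 <= rho t x ;
  sol_mass : forall t, 0 <= t -> (\int[leb]_x (rho t x)%:E = 1)%E ;
  sol_smooth : smooth_pos (densT H eps rho) ;
  sol_pde : forall t x, 0 < t ->
    tau eps * d_t rho t x =
    derive1 (fun y => d_x rho t y + eps ^- 2 * rho t y * derive1 H y) x ;
  sol_L2_init :
    (\int[leb]_x (gamma H eps x *
       (densT H eps rho t x - dens H eps rho0 x) ^+ 2)%:E)%E
    @[t --> 0^'+] --> 0%E ;
  sol_energy : forall t, 0 <= t ->
    (\int[leb]_x (gamma H eps x * densT H eps rho t x ^+ 2)%:E
     + (2 / tau eps)%:E *
       \int[leb]_(s in `[0%R, t])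
         \int[leb]_x (gamma H eps x * d_x (densT H eps rho) s x ^+ 2)%:E
     = \int[leb]_x (gamma H eps x * dens H eps rho0 x ^+ 2)%:E)%E ;
  sol_dissipation : forall t, 0 < t ->
    ((2 * tau eps)^-1%:E *
       \int[leb]_x (gamma H eps x * d_x (densT H eps rho) t x ^+ 2)%:E
     + \int[leb]_(s in `[0%R, t])
         \int[leb]_x (d_t rho s x ^+ 2 / gamma H eps x)%:E
     = (2 * tau eps)^-1%:E *
       \int[leb]_x (gamma H eps x * du0 x ^+ 2)%:E)%E
}.

(* Convergence of rho_(e n) and of its time derivative; the weak-star limits
   are written through the action of the limit measures
   (u delta_1 + (2 - u) delta_-1) / 2 and (du delta_1 - du delta_-1) / 2
   on test functions. *)
Record limit_of (R : realType) (alpha T : R) (e : nat -> R)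
    (rho : R -> R -> R -> R) (u du : R -> R) : Prop := LimitOf {
  lim_rho : forall t, t \in `[0, T] -> forall phi, C0 phi ->
    \int[leb]_x (phi x * rho (e n) t x) @[n --> \oo]
    --> 2^-1 * (u t * phi 1 + (2 - u t) * phi (-1)) ;
  lim_rho_Jp : {uniform `[0, T],
    (fun n t => \int[leb]_(x in J alpha 1 (e n)) rho (e n) t x) @ \oo
    --> (fun t => 2^-1 + 2^-1 * (u t - 1))} ;
  lim_rho_Jm : {uniform `[0, T],
    (fun n t => \int[leb]_(x in J alpha (-1) (e n)) rho (e n) t x) @ \oo
    --> (fun t => 2^-1 - 2^-1 * (u t - 1))} ;
  lim_rho_Jbar : {uniform `[0, T],
    (fun n t => \int[leb]_(x in Jbar alpha (e n)) rho (e n) t x) @ \oo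
    --> (fun=> 0)} ;
  lim_dt : forall phi, C0_strip T phi ->
    \int[leb]_(t in `[0, T])
      (\int[leb]_x (phi (t, x) * d_t (rho (e n)) t x)) @[n --> \oo]
    --> \int[leb]_(t in `[0, T])
          (2^-1 * (du t * phi (t, 1) - du t * phi (t, -1))) ;
  lim_dt_Jp : weakL2_cvg `[0, T]
    (fun n t => \int[leb]_(x in J alpha 1 (e n)) d_t (rho (e n)) t x)
    (fun t => 2^-1 * du t) ;
  lim_dt_Jm : weakL2_cvg `[0, T]
    (fun n t => \int[leb]_(x in J alpha (-1) (e n)) d_t (rho (e n)) t x)
    (fun t => - (2^-1 * du t)) ;
  lim_dt_Jbar :
    (\int[leb]_(t in `[0%R, T])
      (\int[leb]_(x in Jbar alpha (e n)) `|d_t (rho (e n)) t x|%:E) ^+ 2)%E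
    @[n --> \oo] --> 0%E
}.

(* Main.v *)
Require Import Defs.
From mathcomp Require Import all_boot all_order all_algebra.
From mathcomp Require Import ring lra.
From mathcomp Require Import all_classical all_reals all_analysis.
From mathcomp Require Import measurable_realfun.
Import Order.TTheory GRing.Theory Num.Theory.
Import numFieldNormedType.Exports.
Local Open Scope ring_scope.
Local Open Scope classical_set_scope.
Set Implicit Arguments.
Unset Strict Implicit.
Unset Printing Implicit Defensive.

(** Completing the square, the integrand of the functional at [v] is
      [c / (4 k) * ((v + k (u - 1))^2 - k^2 (u - 1)^2)],
    where [c = ln (u / (2 - u)) / (u - 1)] (and [c = 2] at [u = 1]) is positive
    for [0 < u < 2].  It is minimised pointwise by [v = k (1 - u)]
    ([minimal_rate]), so the theorem says that the limit solves the linear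
    reaction equation [du = k (1 - u)] almost everywhere.  That equation is
    obtained here directly from the diffusion equation ([limit_ode]).

    Write [w] for the density of [rho] with respect to [gamma].  The equation is
    the conservation law [d_t rho = d_x F] with flux [F = gamma d_x w / tau]
    ([is_derive_flux]), and the dissipation identity bounds
    [int gamma (d_x w)^2] by [C tau] at every positive time ([energy_bound]).
    Three consequences hold at each such time.
    - Near each well [1 / gamma] is exponentially smaller than [1 / tau], so [w] is
      nearly constant there ([dens_oscillation]).  As the well carries
      [gamma]-mass about [1/2], this constant is about twice the [rho]-mass of the
      well: [w] tends to [u] near [1] and to [2 - u] near [-1] ([dens_near_well]).
    - Somewhere in [[2, 3]], where [H >= 1], the flux is of order [sqrt eps]
      ([tail_flux_small]).
    - On the barrier [[-1/2, 1/2]] the flux equals, up to this tail flux, minus the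
      rate of change [A] of the mass of [J+], with an error at most
      [D = int_Jbar |d_t rho|].  Integrating [d_x w = tau F / gamma] over the
      barrier turns this into
      [A = - (w (1/2) - w (-1/2)) / (tau N)] with [N = int 1 / gamma] over the
      barrier, up to the tail flux and [D] ([barrier_flux_balance]).

    Laplace's method at the wells and at the barrier top gives [tau N --> 4 / k]
    ([resistance_asymptotics]), so the right-hand side converges pointwise and
    boundedly to [- k (u - 1) / 2], while [A] converges weakly in [L^2] to
    [du / 2] and [D] tends to [0] in [L^2].  The two limits therefore agree
    ([weak_pointwise_limit]). *)

(** * Monotonicity of the integral of arbitrary functions *)

Section IntegralMonotonicity.
Context {d : measure_display} {T : measurableType d} {R : realType}.
Variables (mu : {measure set T -> \bar R}) (D : set T).
Local Open Scope ereal_scope.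

(** The integral of a nonnegative function is the supremum of the integrals of
    the simple functions below it, hence is monotone on all functions.  This
    serves for functions such as [t |-> int_Jbar |d_t rho|]. *)
Lemma ge0_le_integral_nomeas (f1 f2 : T -> \bar R) :
  (forall x, D x -> 0 <= f1 x) -> (forall x, D x -> f1 x <= f2 x) ->
  \int[mu]_(x in D) f1 x <= \int[mu]_(x in D) f2 x.
Proof.
move=> f10 f12.
have f20 x : D x -> 0 <= f2 x by move=> Dx; exact: le_trans (f10 _ Dx) (f12 _ Dx).
rewrite !ge0_integralE//.
apply: le_ereal_sup => _ /= [h hf <-]; exists h => // x.
apply: le_trans (hf x) _; rewrite /patch; case: ifPn => // /[!inE]; exact: f12.
Qed.

Lemma ge0_subset_integral_nomeas (A : set T) (f : T -> \bar R) :
  A `<=` D -> (forall x, D x -> 0 <= f x) ->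
  \int[mu]_(x in A) f x <= \int[mu]_(x in D) f x.
Proof.
move=> AD f0; rewrite [leLHS]integral_mkcond [leRHS]integral_mkcond.
have h x : 0 <= (f \_ D) x by apply: erestrict_ge0.
rewrite !ge0_integralTE//; last by move=> x; apply: erestrict_ge0 => y /AD; exact: f0.
apply: le_ereal_sup => _ /= [k hk <-]; exists k => // x.
apply: le_trans (hk x) _; rewrite !patchE; case: ifPn => [/[!inE] Ax|_].
  by rewrite mem_set//; exact: AD.
by move: (h x); rewrite patchE.
Qed.

(** Positive and negative parts are compared separately; the subtraction of
    extended reals is monotone even when both parts are infinite. *)
Lemma le_integral_nomeas (f1 f2 : T -> \bar R) :
  (forall x, D x -> f1 x <= f2 x) ->
  \int[mu]_(x in D) f1 x <= \int[mu]_(x in D) f2 x.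
Proof.
move=> f12; rewrite [leLHS]integralE [leRHS]integralE.
apply: leeB; apply: ge0_le_integral_nomeas => x Dx.
- exact: funepos_ge0.
- by apply: (funepos_le (D := D)) => //; [move=> y /set_mem; exact: f12|exact: mem_set].
- exact: funeneg_ge0.
- by apply: (funeneg_le (D := D)) => //; [move=> y /set_mem; exact: f12|exact: mem_set].
Qed.

End IntegralMonotonicity.

(** * Laplace asymptotics *)

Lemma cvgM_right0 (R : realType) (f1 f2 : R -> R) (x y : R) :
  f1 z @[z --> 0^'+] --> x -> f2 z @[z --> 0^'+] --> y ->
  f1 z * f2 z @[z --> 0^'+] --> x * y.
Proof. exact: cvgM. Qed.

Lemma cvg_cst_right0 (R : realType) (y : R) : y @[z --> (0 : R)^'+] --> y.
Proof. exact: cvg_cst. Qed.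

Section Laplace.
Context {R : realType}.
Implicit Types (a b c d p eps : R).

Lemma expR_sqr_decay c eps : 0 < c -> 0 < eps ->
  expR (- (c / eps ^+ 2)) <= 4 * eps ^+ 4 / c ^+ 2.
Proof.
move=> c0 e0; set y := c / eps ^+ 2.
have y0 : 0 < y by rewrite divr_gt0// exprn_gt0.
have h : y ^+ 2 / 4 <= expR y.
  have -> : expR y = expR (y / 2) ^+ 2.
    by rewrite -expRM_natl; congr expR; rewrite mulrC divfK.
  have := expR_ge1Dx (y / 2); set z := expR _ => hz; nra.
have -> : 4 * eps ^+ 4 / c ^+ 2 = (y ^+ 2 / 4)^-1.
  by rewrite /y; field; rewrite !gt_eqF.
by rewrite expRN lef_pV2// posrE ?expR_gt0// divr_gt0// exprn_gt0.
Qed.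

Lemma cvg_expR_decay c : 0 < c ->
  eps ^- 2 * expR (- (c / eps ^+ 2)) @[eps --> 0^'+] --> (0 : R).
Proof.
move=> c0.
apply: (@squeeze_cvgr _ _ _ _ (fun=> 0) (fun eps : R => 4 / c ^+ 2 * eps ^+ 2)).
- near=> eps.
  have e0 : 0 < eps by near: eps; exact: nbhs_right_gt.
  rewrite mulr_ge0 ?expR_ge0 ?invr_ge0 ?exprn_ge0 ?(ltW e0)//=.
  rewrite [leLHS]mulrC ler_pdivrMr ?exprn_gt0//.
  by apply: le_trans (expR_sqr_decay c0 e0) _; rewrite le_eqVlt; apply/orP; left;
    apply/eqP; field; rewrite gt_eqF.
- exact: cvg_cst.
- have : 4 / c ^+ 2 * eps ^+ 2 @[eps --> (0:R)] --> 4 / c ^+ 2 * 0 ^+ 2.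
    by apply: cvgM; [exact: cvg_cst|exact: sqr_continuous].
  by rewrite expr0n/= mulr0; exact: cvg_at_right_filter.
Unshelve. all: end_near. Qed.

Lemma gauss_integral_scaled b p eps : 0 < b -> 0 < eps ->
  (\int[leb]_x (expR (- (b * (x - p) ^+ 2 / eps ^+ 2)))%:E =
   (eps * Num.sqrt (pi / b))%:E)%E.
Proof.
move=> b0 e0; set s := eps / Num.sqrt (2 * b).
have b20 : 0 < 2 * b by rewrite mulr_gt0.
have s0 : 0 < s by rewrite divr_gt0// sqrtr_gt0.
have s2 : s ^+ 2 = eps ^+ 2 / (2 * b).
  by rewrite expr_div_n sqr_sqrtr// ltW.
have pk : (normal_peak s)^-1 = eps * Num.sqrt (pi / b).
  rewrite /normal_peak invrK s2.
  have -> : eps ^+ 2 / (2 * b) * pi *+ 2 = eps ^+ 2 * (pi / b).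
    by rewrite -mulr_natr; field; rewrite gt_eqF.
  by rewrite sqrtrM ?exprn_ge0 ?ltW// sqrtr_sqr gtr0_norm.
have pk0 : 0 < normal_peak s by rewrite normal_peak_gt0// gt_eqF.
have E x : expR (- (b * (x - p) ^+ 2 / eps ^+ 2)) = (normal_peak s)^-1 * normal_pdf p s x.
  rewrite normal_pdfE ?gt_eqF// mulKf ?gt_eqF// /normal_fun s2; congr expR.
  by rewrite -mulr_natr; field; rewrite !gt_eqF.
under eq_integral do rewrite E EFinM.
rewrite ge0_integralZl//=.
- by rewrite integral_normal_pdf mule1 pk.
- by apply/measurable_EFinP; exact: measurable_normal_pdf.
- by move=> x _; rewrite lee_fin normal_pdf_ge0.
- by rewrite lee_fin invr_ge0 ltW.
Qed.

Lemma measurable_gauss b p eps :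
  measurable_fun [set: measurableTypeR R] (fun x => expR (- (b * (x - p) ^+ 2 / eps ^+ 2))).
Proof.
apply: measurableT_comp => //; apply: measurableT_comp => //.
apply: measurable_funM => //; apply: measurable_funM => //.
by apply: measurable_funX; exact: measurable_funB.
Qed.

(** Near [p] the integrand lies between the gaussians of curvatures
    [a / 2 + d] and [a / 2 - d], whose integrals over the line are
    [eps * sqrt (pi / (a / 2 +- d))]; the rest of [S], and the gaussian tails,
    are exponentially small.  The mass far from [p] is controlled by the
    integrability at the single value [eps1]. *)
Lemma laplace_asymptotics (G : R -> R) (S : set (measurableTypeR R)) p a eps1 :
  measurable S -> measurable_fun [set: measurableTypeR R] G -> 0 < a -> 0 < eps1 ->
  leb.-integrable S (EFin \o (fun x => expR (- (G x / eps1 ^+ 2)))) ->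
  (forall d, 0 < d -> \forall y \near p,
     S y /\ `|G y - a / 2 * (y - p) ^+ 2| <= d * (y - p) ^+ 2) ->
  (forall r, 0 < r -> exists2 h, 0 < h &
     forall x, S x -> r <= `|x - p| -> h <= G x) ->
  eps^-1 * \int[leb]_(x in S) expR (- (G x / eps ^+ 2)) @[eps --> 0^'+]
    --> Num.sqrt (2 * pi / a).
Proof.
move=> mS mG a0 e10 iS hq hfar.
set I := fun eps => \int[leb]_(x in S) expR (- (G x / eps ^+ 2)).
pose I1 := I eps1.
have mB eps : measurable_fun [set: measurableTypeR R] (fun x => expR (- (G x / eps ^+ 2))).
  by apply: measurableT_comp => //; apply: measurableT_comp => //; exact: measurable_funM.
(* The error terms are absolute, so that letting [d] tend to 0 comes last. *)
have key d : 0 < d < a / 2 -> exists K : R -> R, [/\ K x @[x --> 0^'+] --> 0 &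
    \forall eps \near 0^'+,
      Num.sqrt (pi / (a / 2 + d)) - K eps <= eps^-1 * I eps
        <= Num.sqrt (pi / (a / 2 - d)) + K eps].
  move=> /andP[d0 da].
  have [r /= r0 Hr] := hq d d0.
  have {}Hr x : `|x - p| < r -> S x /\ `|G x - a / 2 * (x - p) ^+ 2| <= d * (x - p) ^+ 2.
    by move=> xr; apply: Hr; rewrite /ball/= distrC.
  have [h h0 Hh] := hfar r r0.
  pose bp := a / 2 + d; pose bm := a / 2 - d.
  have bp0 : 0 < bp by rewrite addr_gt0// divr_gt0.
  have bm0 : 0 < bm by rewrite subr_gt0.
  pose g b x eps := expR (- (b * (x - p) ^+ 2 / eps ^+ 2)).
  pose K1 eps := eps^-1 * expR (- (h / eps ^+ 2)) * expR (h / eps1 ^+ 2) * I1.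
  pose K2 eps := expR (- (bp / 2 * r ^+ 2 / eps ^+ 2)) * Num.sqrt (pi / (bp / 2)).
  have I10 : 0 <= I1 by apply: Rintegral_ge0 => x _; exact: expR_ge0.
  have K10 eps : 0 < eps -> 0 <= K1 eps.
    by move=> e0; rewrite !mulr_ge0 ?expR_ge0// invr_ge0 ltW.
  have K20 eps : 0 <= K2 eps by rewrite mulr_ge0 ?expR_ge0 ?sqrtr_ge0.
  (* Far from [p], [G / eps^2 >= G / eps1^2 + h / eps^2 - h / eps1^2]. *)
  have upper eps : 0 < eps <= eps1 ->
     leb.-integrable S (EFin \o (fun x => expR (- (G x / eps ^+ 2)))) /\
     I eps <= eps * Num.sqrt (pi / bm) + expR (- (h / eps ^+ 2)) * expR (h / eps1 ^+ 2) * I1.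
    move=> /andP[e0 e1]; set k := expR (- (h / eps ^+ 2)) * expR (h / eps1 ^+ 2).
    have ptw x : S x -> expR (- (G x / eps ^+ 2)) <=
        g bm x eps + k * expR (- (G x / eps1 ^+ 2)).
      move=> Sx; have [xr|xr] := ltP `|x - p| r.
        rewrite ler_wpDr ?mulr_ge0 ?expR_ge0// ler_expR lerN2 ler_pM2r ?invr_gt0 ?exprn_gt0//.
        have [_] := Hr x xr; rewrite ler_norml => /andP[+ _]; rewrite /bm; lra.
      rewrite ler_wpDl ?expR_ge0// /k -!expRD ler_expR.
      have hG := Hh x Sx xr.
      have ie : (eps1 ^+ 2)^-1 <= (eps ^+ 2)^-1.
        by rewrite lef_pV2 ?posrE ?exprn_gt0// ler_pXn2r ?nnegrE ?(ltW e0) ?(ltW e10).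
      have : 0 <= (G x - h) * ((eps ^+ 2)^-1 - (eps1 ^+ 2)^-1) by rewrite mulr_ge0 ?subr_ge0.
      by move: (eps ^+ 2)^-1 (eps1 ^+ 2)^-1 => X Y; lra.
    have ig : leb.-integrable setT (EFin \o (fun x => g bm x eps)).
      apply/integrableP; split; first by apply/measurable_EFinP; exact: measurable_gauss.
      under eq_integral do rewrite /= ger0_norm ?expR_ge0//.
      by rewrite gauss_integral_scaled// ltry.
    have igS : leb.-integrable S (EFin \o (fun x => g bm x eps)).
      exact: integrableS ig.
    have ik : leb.-integrable S (EFin \o (fun x => k * expR (- (G x / eps1 ^+ 2)))).
      by have := @integrableZl _ _ R leb S mS k _ iS; apply: eq_integrable.
    have ib : leb.-integrable S (EFin \o (fun x => g bm x eps + k * expR (- (G x / eps1 ^+ 2)))).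
      by have := integrableD mS igS ik; apply: eq_integrable.
    have iI : leb.-integrable S (EFin \o (fun x => expR (- (G x / eps ^+ 2)))).
      apply: (le_integrable mS _ _ ib).
        by apply/measurable_EFinP; exact: measurable_funTS.
      move=> x Sx; rewrite !abse_EFin lee_fin ger0_norm ?expR_ge0// ger0_norm ?ptw//.
      by rewrite addr_ge0 ?mulr_ge0 ?expR_ge0.
    split => //; apply: le_trans (le_Rintegral mS iI ib ptw) _.
    rewrite RintegralD// RintegralZl// lerD2r.
    rewrite -lee_fin -(gauss_integral_scaled p bm0 e0) /Rintegral fineK.
      by apply: ge0_subset_integral => //; [apply/measurable_EFinP; exact: measurable_gauss
        |move=> x _; rewrite lee_fin expR_ge0].
    exact: integrable_fin_num.
  (* For [|x - p| >= r], half of the exponent of the gaussian is kept to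
     integrate and the other half gives the exponentially small factor. *)
  have lower eps : 0 < eps <= eps1 ->
     eps * Num.sqrt (pi / bp) <= I eps + eps * K2 eps.
    move=> e01; have [iI _] := upper _ e01; have /andP[e0 e1] := e01.
    pose k := expR (- (bp / 2 * r ^+ 2 / eps ^+ 2)).
    pose F x := (fun x => expR (- (G x / eps ^+ 2))) \_ S x.
    have ptw x : g bp x eps <= F x + k * g (bp / 2) x eps.
      rewrite /F patchE; have [xr|xr] := ltP `|x - p| r.
        have [Sx] := Hr x xr; rewrite mem_set// ler_norml => /andP[_ hx].
        rewrite ler_wpDr ?mulr_ge0 ?expR_ge0// ler_expR lerN2.
        rewrite ler_pM2r ?invr_gt0 ?exprn_gt0//.
        by rewrite /bp; move: hx; lra.
      rewrite ler_wpDl//; first by case: ifP; rewrite // expR_ge0.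
      rewrite /k -expRD ler_expR -opprD lerN2 -mulrDl ler_pM2r ?invr_gt0 ?exprn_gt0//.
      have : r ^+ 2 <= (x - p) ^+ 2.
        by rewrite -[leRHS]real_normK ?num_real// ler_pXn2r ?nnegrE// ltW.
      rewrite -subr_ge0 => /(mulr_ge0 (ltW bp0)).
      by move: ((x - p) ^+ 2) (r ^+ 2) => X Y; lra.
    have FE : (\int[leb]_x (F x)%:E)%E = (I eps)%:E.
      rewrite /I /Rintegral fineK; last exact: integrable_fin_num.
      by rewrite [RHS]integral_mkcond; apply: eq_integral => x _; rewrite restrict_EFin.
    have mF : measurable_fun [set: measurableTypeR R] F.
      have [+ _] := measurable_restrictT (fun x => expR (- (G x / eps ^+ 2))) mS.
      by apply; exact: (measurable_funTS (mB eps)).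
    have F0 x : 0 <= F x by rewrite /F patchE; case: ifP; rewrite // expR_ge0.
    rewrite -lee_fin -(gauss_integral_scaled p bp0 e0) EFinD -FE.
    have -> : ((eps * K2 eps)%:E = \int[leb]_x (k * g (bp / 2) x eps)%:E)%E.
      under eq_integral do rewrite EFinM.
      rewrite ge0_integralZl//=; last 3 first.
      - by apply/measurable_EFinP; exact: measurable_gauss.
      - by move=> x _; rewrite lee_fin expR_ge0.
      - by rewrite lee_fin expR_ge0.
      by rewrite gauss_integral_scaled ?divr_gt0// -EFinM /K2 mulrCA.
    rewrite -ge0_integralD//; last 4 first.
    - by move=> x _; rewrite lee_fin.
    - exact/measurable_EFinP.
    - by move=> x _; rewrite lee_fin mulr_ge0 ?expR_ge0.
    - by apply/measurable_EFinP; apply: measurable_funM => //; exact: measurable_gauss.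
    by apply: ge0_le_integral_nomeas => x _; rewrite ?lee_fin ?expR_ge0// ptw.
  have id0 : (eps : R) @[eps --> 0^'+] --> (0 : R) by exact: cvg_at_right_filter.
  exists (fun eps => K1 eps + K2 eps); split.
    have hK1 : K1 x @[x --> 0^'+] --> 0.
      have := cvgM_right0 (cvgM_right0 id0 (cvg_expR_decay h0))
        (@cvg_cst_right0 _ (expR (h / eps1 ^+ 2) * I1)).
      rewrite !mul0r; apply: cvg_trans; apply: near_eq_cvg; near=> eps.
      have e0 : 0 < eps by near: eps; exact: nbhs_right_gt.
      by rewrite /= /K1; field; rewrite !gt_eqF.
    have hK2 : K2 x @[x --> 0^'+] --> 0.
      have c0 : 0 < bp / 2 * r ^+ 2 by rewrite mulr_gt0 ?divr_gt0 ?exprn_gt0.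
      have := cvgM_right0 (cvgM_right0 (cvgM_right0 id0 id0) (cvg_expR_decay c0))
        (@cvg_cst_right0 _ (Num.sqrt (pi / (bp / 2)))).
      rewrite !mul0r; apply: cvg_trans; apply: near_eq_cvg; near=> eps.
      have e0 : 0 < eps by near: eps; exact: nbhs_right_gt.
      by rewrite /= /K2 -expr2 mulrA divff ?mul1r// expf_neq0// gt_eqF.
    by have : K1 x + K2 x @[x --> 0^'+] --> (0 + 0 : R) by [exact: cvgD]; rewrite addr0.
  near=> eps.
  have e0 : 0 < eps by near: eps; exact: nbhs_right_gt.
  have e1 : eps <= eps1 by near: eps; exact: nbhs_right_le.
  have e01 : 0 < eps <= eps1 by rewrite e0.
  have [_ up] := upper _ e01; have lo := lower _ e01.
  apply/andP; split.
    rewrite [leRHS]mulrC ler_pdivlMr// mulrBl lerBlDr [leLHS]mulrC (le_trans lo)// lerD2l.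
    by rewrite [leLHS]mulrC ler_pM2r// lerDr K10.
  have E : expR (- (h / eps ^+ 2)) * expR (h / eps1 ^+ 2) * I1 = K1 eps * eps.
    by rewrite /K1; field; rewrite gt_eqF.
  rewrite [leLHS]mulrC ler_pdivrMr// (le_trans up)// E.
  have := mulr_ge0 (K20 eps) (ltW e0).
  by move: (Num.sqrt _) (K1 eps) (K2 eps) => X Y W; lra.
apply/cvgrPdist_le => /= eta eta0.
have c0 : pi / (a / 2 + d) @[d --> (0:R)] --> pi / (a / 2 + 0).
  apply: cvgM; first exact: cvg_cst.
  apply: cvgV; first by rewrite addr0 gt_eqF// divr_gt0.
  by apply: cvgD; [exact: cvg_cst|exact: cvg_id].
have c1 : Num.sqrt (pi / (a / 2 + d)) @[d --> (0:R)] --> Num.sqrt (2 * pi / a).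
  have -> : 2 * pi / a = pi / (a / 2 + 0) :> R by field; rewrite gt_eqF.
  by apply: continuous_cvg; [exact: sqrt_continuous|exact: c0].
have eta20 : 0 < eta / 2 by rewrite divr_gt0.
move/cvgrPdist_le : c1 => /(_ _ eta20)[r /= r0 Hr].
pose d := Num.min (r / 2) (a / 4).
have d0 : 0 < d by rewrite lt_min !divr_gt0.
have da : d < a / 2.
  have : d <= a / 4 by rewrite ge_min lexx orbT.
  by lra.
have dr : d < r.
  have : d <= r / 2 by rewrite ge_min lexx.
  by lra.
have [K [K0 HK]] := key d (introT andP (conj d0 da)).
have Hp : `|Num.sqrt (2 * pi / a) - Num.sqrt (pi / (a / 2 + d))| <= eta / 2.
  by apply: Hr; rewrite /ball/= sub0r normrN gtr0_norm.
have Hm : `|Num.sqrt (2 * pi / a) - Num.sqrt (pi / (a / 2 - d))| <= eta / 2.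
  by apply: (Hr (- d)); rewrite /ball/= sub0r opprK gtr0_norm.
near=> eps.
have : `|0 - K eps| <= eta / 2.
  by near: eps; move/cvgrPdist_le : K0; exact.
have : Num.sqrt (pi / (a / 2 + d)) - K eps <= eps^-1 * I eps
        <= Num.sqrt (pi / (a / 2 - d)) + K eps by near: eps.
move: Hp Hm; rewrite sub0r normrN !ler_norml -/(I eps).
move: (Num.sqrt _) (Num.sqrt _) (Num.sqrt _) (K eps) (eps^-1 * _) => A B D k J.
by lra.
Unshelve. all: end_near. Qed.

(** The difference with the parabola has derivative [o(|y - p|)] because [f'] is
    differentiable at [p]; the mean value theorem integrates this bound. *)
Lemma second_order_expansion (f : R -> R) p :
  (forall x, derivable f x 1) -> derivable (derive1 f) p 1 ->
  f p = 0 -> derive1 f p = 0 ->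
  forall d, 0 < d -> \forall y \near p,
    `|f y - derive1n 2 f p / 2 * (y - p) ^+ 2| <= d * (y - p) ^+ 2.
Proof.
move=> df ddf fp dfp d d0; set a := derive1n 2 f p.
have H1 : \forall y \near p, `|derive1 f y - a * (y - p)| <= d * `|y - p|.
  have /cvgrPdist_le/(_ d d0)[r /= r0 Hr] := ddf.
  exists r => //= y yr; have [->|yp] := eqVneq y p.
    by rewrite dfp !subrr mulr0 subrr normr0 mulr0.
  have yp0 : y - p != 0 by rewrite subr_eq0.
  have := Hr (y - p); rewrite /ball/= sub0r normrN distrC => /(_ yr yp0).
  have -> : lim (h^-1 *: (derive1 f (h%:A + p) - derive1 f p) @[h --> 0^']) = a.
    by rewrite /a /= [RHS]derive1E.
  rewrite /GRing.scale/= mulr1 subrK dfp subr0 distrC => h.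
  rewrite -ler_pdivrMr ?normr_gt0// -normfV -normrM.
  by rewrite mulrBl mulfK// [derive1 f y / _]mulrC distrC.
have [r /= r0 Hr] := H1.
exists r => //= y yr.
pose phi y := f y - a / 2 * (y - p) ^+ 2.
have dphi (x : R) : is_derive x 1 phi (derive1 f x - a * (x - p)).
  have dfx : is_derive x 1 f (derive1 f x) by rewrite derive1E; exact/derivableP.
  rewrite /phi; apply: is_derive_eq.
  by rewrite /GRing.scale/=; field.
have cphi : continuous phi.
  by move=> x; apply/differentiable_continuous/derivable1_diffP; have [] := dphi x.
have phip : phi p = 0 by rewrite /phi fp subrr expr0n/= mulr0 subrr.
have bound c : (`|c - p| <= `|y - p|) ->
    `|(derive1 f c - a * (c - p)) * (y - p)| <= d * (y - p) ^+ 2.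
  move=> cy; rewrite normrM -[in leRHS]real_normK ?num_real// expr2 mulrA ler_wpM2r//.
  apply: le_trans (ler_wpM2l (ltW d0) cy); apply: Hr.
  by rewrite /ball/= distrC (le_lt_trans cy)// distrC.
rewrite -/(phi y) -[phi y]subr0 -phip; have [yp|py] := leP y p.
  have [c] := MVT_segment yp (fun x _ => dphi x) (continuous_subspaceT cphi).
  rewrite in_itv/= => /andP[yc cp] E.
  rewrite distrC E -normrN -mulrN opprB; apply: bound.
  by rewrite distrC [leRHS]distrC !ger0_norm ?subr_ge0// lerB.
have [c] := MVT_segment (ltW py) (fun x _ => dphi x) (continuous_subspaceT cphi).
rewrite in_itv/= => /andP[pc cy] ->; apply: bound.
by rewrite !ger0_norm ?subr_ge0 ?(ltW py)// lerB.
Qed.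

End Laplace.

(** * The double-well potential *)

Section Potential.
Context {R : realType} (H : R -> R).
Hypothesis HH : potential H.
Implicit Types (x s r rho eps : R).

Lemma pot_derivable x : derivable H x 1.
Proof. exact: (@pot_smooth _ _ HH 0%N x). Qed.

Lemma pot_continuous : continuous H.
Proof.
move=> x; apply/differentiable_continuous/derivable1_diffP; exact: pot_derivable.
Qed.

Lemma pot_derivable_derive x : derivable (derive1 H) x 1.
Proof. exact: (@pot_smooth _ _ HH 1%N x). Qed.

Lemma pot_abs x : H `|x| = H x.
Proof. by case: (ler0P x) => // _; rewrite (pot_even HH). Qed.

Lemma pot_decr x y : 0 <= x -> x < y -> y <= 1 -> H y < H x.
Proof.
move=> x0 xy y1.
have dneg z : z \in `]0, 1[%R -> derive1 H z < 0.
  rewrite in_itv/= => /andP[z0 z1].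
  by have := @pot_in _ _ HH z; rewrite gtr0_norm// z0 z1 pmulr_rlt0//; apply.
have cH : {within `[0, 1], continuous H} by exact: continuous_subspaceT pot_continuous.
apply: (ltr0_derive1_lt_cc (fun z _ => @pot_derivable z) dneg cH) => //;
  by rewrite in_itv/=; apply/andP; split; lra.
Qed.

Lemma pot_incr x y : 1 <= x -> x <= y -> H x <= H y.
Proof.
move=> x0 xy.
have dpos z : z \in `]1, +oo[%R -> 0 <= derive1 H z.
  rewrite in_itv/= andbT => z1; have z0 : 0 < z by exact: lt_trans z1.
  have := @pot_out _ _ HH z; rewrite gtr0_norm// => /(_ z1).
  by rewrite pmulr_rgt0// => /ltW.
have cH : {within `[1, +oo[, continuous H} by exact: continuous_subspaceT pot_continuous.
exact: (ger0_derive1_ndecry (fun z _ => @pot_derivable z) dpos cH).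
Qed.

Lemma pot_incr_strict x y : 1 <= x -> x < y -> H x < H y.
Proof.
move=> x0 xy.
have dpos z : z \in `]1, y[%R -> 0 < derive1 H z.
  rewrite in_itv/= => /andP[z1 _]; have z0 : 0 < z by exact: lt_trans z1.
  have := @pot_out _ _ HH z; rewrite gtr0_norm// => /(_ z1).
  by rewrite pmulr_rgt0.
have cH : {within `[1, y], continuous H} by exact: continuous_subspaceT pot_continuous.
apply: (gtr0_derive1_lt_cc (fun z _ => @pot_derivable z) dpos cH) => //;
  by rewrite in_itv/=; apply/andP; split; lra.
Qed.

Lemma pot_ge1 x : 2 <= x -> 1 <= H x.
Proof.
move=> x2; have [_ <- _] := pot_one HH; apply: pot_incr => //; lra.
Qed.

Lemma pot_away_well r : 0 < r ->
  exists2 h, 0 < h & forall x, 0 <= x -> r <= `|x - 1| -> h <= H x.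
Proof.
move=> r0; pose q := Num.min r 1.
have q0 : 0 < q by rewrite lt_min r0 ltr01.
have qr : q <= r by rewrite ge_min lexx.
have q1 : q <= 1 by rewrite ge_min lexx orbT.
have [H1 _] := pot_wells HH.
exists (Num.min (H (1 - q)) (H (1 + q))).
  by rewrite lt_min; apply/andP; split; rewrite -[ltLHS]H1;
    [apply: pot_decr; lra|apply: pot_incr_strict; lra].
move=> x x0; rewrite ge_min; have [x1|x1] := leP x 1.
  rewrite distrC ger0_norm ?subr_ge0// => rx; apply/orP; left.
  have : x <= 1 - q by lra.
  rewrite le_eqVlt => /predU1P[->//|xq]; apply/ltW/pot_decr => //; lra.
rewrite gtr0_norm ?subr_gt0// => rx; apply/orP; right.
by apply: pot_incr; lra.
Qed.

Lemma pot_away_barrier r : 0 < r ->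
  exists2 h, 0 < h & forall x, - 2^-1 <= x <= 2^-1 -> r <= `|x| -> h <= 1 - H x.
Proof.
move=> r0; pose q := Num.min r 2^-1.
have q0 : 0 < q by rewrite lt_min r0 invr_gt0/=.
have q1 : q <= 2^-1 by rewrite ge_min lexx orbT.
have qr : q <= r by rewrite ge_min lexx.
have [H0 _ _] := pot_one HH.
exists (1 - H q); first by rewrite subr_gt0 -[ltRHS]H0; apply: pot_decr; lra.
move=> x; rewrite -ler_norml => xu rx; rewrite lerD2l lerN2 -(pot_abs x).
have : q <= `|x| by exact: le_trans qr rx.
by rewrite le_eqVlt => /predU1P[->//|qx]; apply/ltW/pot_decr => //; lra.
Qed.

Lemma pot_wells_below_barrier : exists2 h, h < 1 &
  forall s x, `|s| = 1 -> `|x - s| <= 2^-1 -> H x <= h.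
Proof.
have [H0 H2 _] := pot_one HH.
have half0 : 0 < (2^-1 : R) by rewrite invr_gt0.
exists (Num.max (H 2^-1) (H (1 + 2^-1))).
  rewrite gt_max; apply/andP; split.
    by rewrite -[ltRHS]H0; apply: pot_decr; lra.
  by rewrite -[ltRHS]H2; apply: pot_incr_strict; lra.
have main x : `|x - 1| <= 2^-1 -> H x <= Num.max (H 2^-1) (H (1 + 2^-1)).
  rewrite ler_norml => /andP[xl xu]; rewrite le_max; have [x1|x1] := leP x 1.
    apply/orP; left; have : 2^-1 <= x by lra.
    by rewrite le_eqVlt => /predU1P[->//|?]; apply/ltW/pot_decr => //; lra.
  by apply/orP; right; apply: pot_incr; lra.
move=> s x s1; case: (ler0P s) s1 => [s0|s0] s1 xs; last by apply: main; rewrite s1 in xs.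
rewrite -(pot_even HH); apply: main; move: xs.
by rewrite -normrN; have -> : - (x - s) = - x - 1 by lra.
Qed.

(** The expansion at [-1] is that at [1] reflected, so it is stated with the
    curvature at [1] for both wells. *)
Lemma pot_expand_well s d : `|s| = 1 -> 0 < d -> \forall y \near s,
  `|H y - derive1n 2 H 1 / 2 * (y - s) ^+ 2| <= d * (y - s) ^+ 2.
Proof.
move=> s1 d0; have [H1 _] := pot_wells HH; have [dH1 _ _] := pot_crit HH.
have := second_order_expansion (@pot_derivable) (@pot_derivable_derive 1) H1 dH1 d0.
case: (ler0P s) s1 => [s0|s0] s1 h; last by rewrite s1.
have -> : s = -1 by rewrite -s1 opprK.
case: h => r /= r0 hr; exists r => //= y yr.
have E : y - -1 = - (- y - 1) by lra.
rewrite E sqrrN -(pot_even HH); apply: hr.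
by move: yr; rewrite /ball_/=; have -> : -1 - y = - (1 - - y) by [lra]; rewrite normrN.
Qed.

Variable eps1 : R.
Hypothesis eps10 : 0 < eps1.
Hypothesis H_int : leb.-integrable [set: R] (EFin \o boltzmann H eps1).

Lemma measurable_pot : measurable_fun [set: measurableTypeR R] H.
Proof. exact: continuous_measurable_fun pot_continuous. Qed.

Lemma continuous_boltzmann eps : continuous (boltzmann H eps).
Proof.
move=> x; apply: continuous_comp; last exact: continuous_expR.
by apply: cvgN; apply: cvgMl; exact: pot_continuous.
Qed.

Lemma boltzmann_integrable eps : 0 < eps -> eps <= eps1 ->
  leb.-integrable [set: R] (EFin \o boltzmann H eps).
Proof.
move=> e0 e1; apply: (le_integrable _ _ _ H_int) => //.
  by apply/measurable_EFinP; exact: continuous_measurable_fun (@continuous_boltzmann eps).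
move=> x _; rewrite !abse_EFin lee_fin !ger0_norm ?expR_ge0// ler_expR lerN2.
apply: ler_wpM2l; first exact: pot_ge0 HH _.
by rewrite lef_pV2 ?posrE ?exprn_gt0// ler_pXn2r ?nnegrE ?(ltW e0) ?(ltW eps10).
Qed.

Let well_curv : 0 < derive1n 2 H 1.
Proof. by have [] := pot_curv HH. Qed.

Lemma laplace_well s rho : `|s| = 1 -> 0 < rho <= 2^-1 ->
  eps^-1 * \int[leb]_(x in `[s - rho, s + rho]) boltzmann H eps x @[eps --> 0^'+]
    --> Num.sqrt (2 * pi / derive1n 2 H 1).
Proof.
move=> s1 /andP[rho0 rho1].
apply: (@laplace_asymptotics _ H _ s _ eps1) => //.
- exact: measurable_pot.
- exact: (integrableS measurableT _ _ H_int).
- move=> d d0; near=> y; split; last by near: y; exact: pot_expand_well.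
  rewrite /= in_itv/=.
  have : `|s - y| < rho by near: y; exact: nbhsx_ballx.
  by rewrite ltr_norml => /andP[? ?]; apply/andP; split; lra.
move=> r r0; have [h h0 Hh] := pot_away_well r0; exists h => // x.
rewrite /= in_itv/= => /andP[xl xu].
case: (ler0P s) s1 => [s0|s0] s1 xs.
  rewrite -(pot_even HH); apply: Hh; first by lra.
  by move: xs; rewrite -normrN; have -> : - (x - s) = - x - 1 by lra.
by apply: Hh; [lra|rewrite s1 in xs].
Unshelve. all: end_near. Qed.

(** By evenness [Z] is twice the integral over the half-line, which contains one
    well only. *)
Lemma laplace_partition :
  eps^-1 * Z H eps @[eps --> 0^'+] --> 2 * Num.sqrt (2 * pi / derive1n 2 H 1).
Proof.
have half : eps^-1 * \int[leb]_(x in `[0, +oo[) boltzmann H eps x @[eps --> 0^'+]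
    --> Num.sqrt (2 * pi / derive1n 2 H 1).
  apply: (@laplace_asymptotics _ H _ 1 _ eps1) => //.
  - exact: measurable_pot.
  - exact: (integrableS measurableT _ _ H_int).
  - move=> d d0; near=> y; split; last by near: y; apply: pot_expand_well => //; exact: normr1.
    rewrite /= in_itv/= andbT.
    have : `|1 - y| < 1 by near: y; exact: nbhsx_ballx.
    by rewrite ltr_norml => /andP[? ?]; lra.
  move=> r r0; have [h h0 Hh] := pot_away_well r0; exists h => // x.
  by rewrite /= in_itv/= andbT; exact: Hh.
have := cvgM (cvg_cst (2:R)) half => /(_ _ _)/=.
apply: cvg_trans; apply: near_eq_cvg; near=> eps.
have e0 : 0 < eps by near: eps; exact: nbhs_right_gt.
have e1 : eps <= eps1 by near: eps; exact: nbhs_right_le.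
rewrite /= mulrCA; congr (_ * _); rewrite /Z /Rintegral.
rewrite ge0_symfun_integralT; last 3 first.
- by move=> x; exact: expR_ge0.
- exact: continuous_boltzmann.
- by move=> x; rewrite /= /boltzmann (pot_even HH).
rewrite -set_itvcy fineM//; apply: integrable_fin_num => //.
apply: (integrableS measurableT) => //; exact: boltzmann_integrable.
Unshelve. all: end_near. Qed.

Lemma laplace_barrier :
  eps^-1 * \int[leb]_(x in `[- 2^-1, 2^-1]) expR (- ((1 - H x) / eps ^+ 2)) @[eps --> 0^'+]
    --> Num.sqrt (2 * pi / `|derive1n 2 H 0|).
Proof.
have [H0 _ _] := pot_one HH; have [_ _ dH0] := pot_crit HH.
have [c0 _ _] := pot_curv HH.
have dG x : derivable (fun y => 1 - H y) x 1.
  by apply: derivableB; [exact: derivable_cst|exact: pot_derivable].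
have dGE : derive1 (fun y => 1 - H y) = (fun y => - derive1 H y).
  apply/funext => x; rewrite !derive1E deriveB ?derive_cst ?sub0r//; exact: pot_derivable.
have ddG : derivable (derive1 (fun y => 1 - H y)) 0 1.
  by rewrite dGE; apply: derivableN; exact: pot_derivable_derive.
have ddGE : derive1n 2 (fun y => 1 - H y) 0 = `|derive1n 2 H 0|.
  rewrite ltr0_norm//; transitivity (derive1 (derive1 (fun y => 1 - H y)) 0) => //.
  by rewrite dGE; exact: (derive1N (@pot_derivable_derive 0)).
apply: (@laplace_asymptotics _ (fun y => 1 - H y) _ 0 _ 1) => //.
- by apply: measurable_funB => //; exact: measurable_pot.
- by rewrite normr_gt0 lt_eqF.
- apply: continuous_compact_integrable; first exact: segment_compact.
  apply: continuous_subspaceT => x; apply: continuous_comp; last exact: continuous_expR.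
  by apply: cvgN; apply: cvgMl; apply: cvgB; [exact: cvg_cst|exact: pot_continuous].
- move=> d d0; near=> y; split.
    rewrite /= in_itv/=.
    have : `|0 - y| < 2^-1 by near: y; apply: nbhsx_ballx; rewrite invr_gt0.
    by rewrite sub0r normrN => /ltW; rewrite ler_norml.
  rewrite -ddGE; near: y; apply: second_order_expansion => //.
    by rewrite H0 subrr.
  by rewrite dGE dH0 oppr0.
by move=> r r0; have [h h0 Hh] := pot_away_barrier r0; exists h => // x;
  rewrite /= in_itv/= subr0; exact: Hh.
Unshelve. all: end_near. Qed.

End Potential.

(** * The Gibbs measure for small noise *)

Section SmallNoise.
Context {R : realType} (H : R -> R).
Hypothesis HH : potential H.
Variable eps1 : R.
Hypothesis eps10 : 0 < eps1.
Hypothesis H_int : leb.-integrable [set: R] (EFin \o boltzmann H eps1).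
Implicit Types (x s eps : R).

(** Equal to [1] near the well [s] and supported within distance [1/2] of it;
    it belongs to the predual of measures, so it detects the mass of [rho] near
    a well in the weak-star limit. *)
Definition cutoff s x : R := Num.max 0 (Num.min 1 (2 - 4 * `|x - s|)).

Lemma cutoff_ge0 s x : 0 <= cutoff s x.
Proof. by rewrite /cutoff le_max lexx. Qed.

Lemma cutoff_le1 s x : cutoff s x <= 1.
Proof. by rewrite /cutoff ge_max ler01 ge_min lexx. Qed.

Lemma cutoff_out s x : 2^-1 <= `|x - s| -> cutoff s x = 0.
Proof.
move=> h; apply/eqP; rewrite eq_le cutoff_ge0 andbT /cutoff ge_max lexx ge_min/=.
by apply/orP; right; lra.
Qed.

Lemma cutoff_in s x : `|x - s| <= 4^-1 -> cutoff s x = 1.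
Proof.
move=> h; apply/eqP; rewrite eq_le cutoff_le1 /cutoff le_max le_min lexx/=.
by apply/orP; right; lra.
Qed.

Lemma continuous_cutoff s : continuous (cutoff s).
Proof.
have max_cont (f g : R -> R) : continuous f -> continuous g ->
    continuous (fun x => Num.max (f x) (g x)).
  move=> cf cg x; under eq_fun do rewrite maxr_absE.
  apply: cvgMl; apply: cvgD; first by apply: cvgD; [exact: cf|exact: cg].
  by apply: cvg_norm; apply: cvgB; [exact: cf|exact: cg].
have min_cont (f g : R -> R) : continuous f -> continuous g ->
    continuous (fun x => Num.min (f x) (g x)).
  move=> cf cg x; under eq_fun do rewrite minr_absE.
  apply: cvgMl; apply: cvgB; first by apply: cvgD; [exact: cf|exact: cg].
  by apply: cvg_norm; apply: cvgB; [exact: cf|exact: cg].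
apply: max_cont; first by move=> x; exact: cvg_cst.
apply: min_cont => x; first exact: cvg_cst.
apply: cvgB; first exact: cvg_cst.
apply: cvgM; first exact: cvg_cst.
by apply: cvg_norm; apply: cvgB; [exact: cvg_id|exact: cvg_cst].
Qed.

Lemma C0_cutoff s : C0 (cutoff s).
Proof.
split; first exact: continuous_cutoff.
- apply/cvgrPdist_le => d d0; near=> x.
  have xs : s + 1 <= x by near: x; apply: nbhs_pinfty_ge; exact: num_real.
  by rewrite cutoff_out ?subrr ?normr0 ?(ltW d0)// (le_trans _ (ler_norm _))//; lra.
- apply/cvgrPdist_le => d d0; near=> x.
  have xs : x <= s - 1 by near: x; apply: nbhs_ninfty_le; exact: num_real.
  rewrite cutoff_out ?subrr ?normr0 ?(ltW d0)// distrC (le_trans _ (ler_norm _))//; lra.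
Unshelve. all: end_near. Qed.

Let c1 := Num.sqrt (2 * pi / derive1n 2 H 1).
Let c10 : 0 < c1.
Proof.
by have [_ h _] := pot_curv HH; rewrite sqrtr_gt0 divr_gt0// mulr_gt0// pi_gt0.
Qed.

Lemma partition_gt0 : \forall eps \near 0^'+, 0 < Z H eps.
Proof.
have h := laplace_partition HH eps10 H_int.
have c20 : 0 < 2 * c1 by rewrite mulr_gt0.
near=> eps.
have e0 : 0 < eps by near: eps; exact: nbhs_right_gt.
have : 0 < eps^-1 * Z H eps by near: eps; exact: (cvgr_gt _ h).
by rewrite pmulr_rgt0 ?invr_gt0.
Unshelve. all: end_near. Qed.

Definition well_mass s eps : R :=
  \int[leb]_(x in `[s - 2^-1, s + 2^-1]) (cutoff s x * gamma H eps x).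

(** The cutoff lies between the indicators of two neighbourhoods of the well,
    which carry the same leading-order mass, half of [Z]. *)
Lemma well_mass_cvg s : `|s| = 1 -> well_mass s eps @[eps --> 0^'+] --> (2^-1 : R).
Proof.
rewrite /well_mass.
move=> s1.
have hZ := laplace_partition HH eps10 H_int.
have hl : eps^-1 * \int[leb]_(x in `[s - 4^-1, s + 4^-1]) boltzmann H eps x
    @[eps --> 0^'+] --> c1 by apply: (laplace_well HH eps10 H_int) => //; lra.
have hu : eps^-1 * \int[leb]_(x in `[s - 2^-1, s + 2^-1]) boltzmann H eps x
    @[eps --> 0^'+] --> c1 by apply: (laplace_well HH eps10 H_int) => //; lra.
have ratio (f : R -> R) : f eps @[eps --> 0^'+] --> c1 ->
    f eps / (eps^-1 * Z H eps) @[eps --> 0^'+] --> (2^-1 : R).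
  move=> hf; have -> : 2^-1 = c1 / (2 * c1) :> R by field; rewrite gt_eqF.
  by apply: cvgM => //; apply: cvgV => //; rewrite gt_eqF// mulr_gt0.
apply: (squeeze_cvgr _ (ratio _ hl) (ratio _ hu)).
near=> eps.
have e0 : 0 < eps by near: eps; exact: nbhs_right_gt.
have Z0 : 0 < Z H eps by near: eps; exact: partition_gt0.
have cb := @continuous_boltzmann _ _ HH eps.
have ib (a b : R) : leb.-integrable `[a, b] (EFin \o boltzmann H eps).
  apply: continuous_compact_integrable; first exact: segment_compact.
  exact: continuous_subspaceT.
have ibb : leb.-integrable `[s - 2^-1, s + 2^-1]
    (EFin \o (fun x => cutoff s x * boltzmann H eps x)).
  apply: continuous_compact_integrable; first exact: segment_compact.
  apply: continuous_subspaceT => x; apply: cvgM; first exact: continuous_cutoff.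
  exact: cb.
have E : \int[leb]_(x in `[s - 2^-1, s + 2^-1]) (cutoff s x * gamma H eps x) =
  (eps^-1 * \int[leb]_(x in `[s - 2^-1, s + 2^-1]) (cutoff s x * boltzmann H eps x))
    / (eps^-1 * Z H eps).
  under eq_Rintegral do rewrite /gamma mulrCA.
  rewrite RintegralZl//; field; rewrite !gt_eqF//.
have pos : 0 < eps^-1 * Z H eps by rewrite mulr_gt0 ?invr_gt0.
rewrite E; apply/andP; split; rewrite ler_pM2r ?invr_gt0// ler_pM2l ?invr_gt0//.
  rewrite /Rintegral fine_le//; [exact: integrable_fin_num|exact: integrable_fin_num|].
  rewrite [leLHS]integral_mkcond [leRHS]integral_mkcond.
  apply: ge0_le_integral_nomeas => x _.
    by apply: erestrict_ge0 => y _; rewrite lee_fin expR_ge0.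
  rewrite !patchE; case: ifPn => [|_].
    rewrite inE/= in_itv/= => /andP[xl xu].
    rewrite mem_set; last by rewrite /= in_itv/=; apply/andP; split; lra.
    rewrite lee_fin cutoff_in ?mul1r// ler_norml; apply/andP; split; lra.
  by case: ifPn => _ //; rewrite lee_fin mulr_ge0 ?cutoff_ge0 ?expR_ge0.
apply: le_Rintegral => // x _.
by rewrite ler_piMl ?expR_ge0 ?cutoff_le1.
Unshelve. all: end_near. Qed.

(** The resistance of the barrier: a constant flux [F] across it comes with the
    jump [tau * F * resistance] of the density [rho / gamma]. *)
Definition resistance eps : R :=
  \int[leb]_(x in `[- 2^-1, 2^-1]) (gamma H eps x)^-1.

(** The factor [exp (-1 / eps^2)] of [tau] cancels the height [H 0 = 1] of the
    barrier, and its factor [eps^-2] cancels the widths of the well (in [Z]) and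
    of the barrier. *)
Lemma resistance_asymptotics :
  tau eps * resistance eps @[eps --> 0^'+] --> 4 / kconst H.
Proof.
rewrite /resistance.
have hZ := laplace_partition HH eps10 H_int; have hB := laplace_barrier HH.
have [k0 k1 _] := pot_curv HH.
have n0 : 0 < `|derive1n 2 H 0| by rewrite normr_gt0 lt_eqF.
have -> : 4 / kconst H = 2 * c1 * Num.sqrt (2 * pi / `|derive1n 2 H 0|).
  have p0 : (0 : R) < pi by exact: pi_gt0.
  rewrite /kconst /c1 -mulrA -sqrtrM; last by rewrite ltW// divr_gt0// mulr_gt0.
  have -> : 2 * pi / derive1n 2 H 1 * (2 * pi / `|derive1n 2 H 0|) =
     (2 * pi) ^+ 2 / (`|derive1n 2 H 0| * derive1n 2 H 1) by field; rewrite !gt_eqF.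
  set q := `|_| * _; have q0 : 0 < q by rewrite mulr_gt0.
  have p20 : 0 <= 2 * pi :> R by rewrite mulr_ge0// ltW.
  have -> : Num.sqrt ((2 * pi) ^+ 2 / q) = 2 * pi / Num.sqrt q.
    by rewrite sqrtrM ?exprn_ge0// sqrtr_sqr ger0_norm// sqrtrV// ltW.
  have sq0 : 0 < Num.sqrt q by rewrite sqrtr_gt0.
  by move: (pi : R) p0 => P p0; field; rewrite !gt_eqF.
apply: cvg_trans (cvgM_right0 hZ hB); apply: near_eq_cvg; near=> eps.
have e0 : 0 < eps by near: eps; exact: nbhs_right_gt.
have Z0 : 0 < Z H eps by near: eps; exact: partition_gt0.
have E x : (gamma H eps x)^-1 =
    (Z H eps * expR (eps ^- 2)) * expR (- ((1 - H x) / eps ^+ 2)).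
  rewrite /gamma /boltzmann invfM invrK -expRN opprK -mulrA -expRD.
  by congr (_ * expR _); field; rewrite gt_eqF.
have -> : \int[leb]_(x in `[- 2^-1, 2^-1]) (gamma H eps x)^-1 = Z H eps * expR (eps ^- 2) *
    \int[leb]_(x in `[- 2^-1, 2^-1]) expR (- ((1 - H x) / eps ^+ 2)).
  under eq_Rintegral do rewrite E.
  rewrite RintegralZl//.
  apply: continuous_compact_integrable; first exact: segment_compact.
  apply: continuous_subspaceT => x; apply: continuous_comp; last exact: continuous_expR.
  by apply: cvgN; apply: cvgMl; apply: cvgB; [exact: cvg_cst|exact: pot_continuous].
have x0 : 0 < expR (eps ^- 2) by exact: expR_gt0.
by rewrite /= /tau expRN; field; rewrite !gt_eqF.
Unshelve. all: end_near. Qed.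

(** With [lam = exp ((1 + h) / 2 / eps^2)], this is the bound on
    [int |d_x w|] over a unit interval where [H <= h] given by
    [|d| <= lam * gamma * d^2 + 1 / (lam * gamma)].  The exponent is half-way
    between [h] and [1], so that both terms decay. *)
Definition oscillation (C h eps : R) : R :=
  expR ((1 + h) / 2 / eps ^+ 2) * (C * tau eps)
  + Z H eps * expR (h / eps ^+ 2) / expR ((1 + h) / 2 / eps ^+ 2).

Lemma oscillation_cvg0 C h : h < 1 -> oscillation C h eps @[eps --> 0^'+] --> (0 : R).
Proof.
move=> h1; pose d := (1 - h) / 2; have d0 : 0 < d by rewrite divr_gt0 ?subr_gt0.
have id0 : (eps : R) @[eps --> 0^'+] --> (0 : R) by exact: cvg_at_right_filter.
have hZ := laplace_partition HH eps10 H_int.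
have D := cvg_expR_decay d0.
have l1 := cvgM_right0 (@cvg_cst_right0 _ C) D.
have l2 := cvgM_right0 (cvgM_right0 hZ (cvgM_right0 id0 (cvgM_right0 id0 id0))) D.
have : (fun eps => C * (eps ^- 2 * expR (- (d / eps ^+ 2))) +
   eps^-1 * Z H eps * (eps * (eps * eps)) * (eps ^- 2 * expR (- (d / eps ^+ 2)))) eps
   @[eps --> 0^'+] --> C * 0 + 2 * c1 * (0 * (0 * 0)) * 0 by exact: cvgD.
rewrite !mulr0 addr0; apply: cvg_trans; apply: near_eq_cvg; near=> eps.
have e0 : 0 < eps by near: eps; exact: nbhs_right_gt.
have E1 : expR ((1 + h) / 2 / eps ^+ 2) = expR (eps ^- 2) * expR (- (d / eps ^+ 2)).
  by rewrite -expRD; congr expR; rewrite /d; field; rewrite gt_eqF.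
have E2 : expR (h / eps ^+ 2) = expR (eps ^- 2) * expR (- (d / eps ^+ 2)) * expR (- (d / eps ^+ 2)).
  by rewrite -!expRD; congr expR; rewrite /d; field; rewrite gt_eqF.
have x0 : 0 < expR (eps ^- 2) by exact: expR_gt0.
have y0 : 0 < expR (- (d / eps ^+ 2)) by exact: expR_gt0.
by rewrite /= /oscillation E1 E2 /tau [expR (- eps ^- 2)]expRN; field; rewrite !gt_eqF.
Unshelve. all: end_near. Qed.

(** Bound on the flux at a point of [[2, 3]], where [gamma <= exp (-1 / eps^2) / Z];
    it is of order [sqrt eps]. *)
Definition tail_flux (C eps : R) : R := Num.sqrt ((C + 1) * (eps ^+ 2 / Z H eps)).

Lemma tail_flux_cvg0 C : tail_flux C eps @[eps --> 0^'+] --> (0 : R).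
Proof.
have id0 : (eps : R) @[eps --> 0^'+] --> (0 : R) by exact: cvg_at_right_filter.
have hZ := laplace_partition HH eps10 H_int.
have hV : (eps^-1 * Z H eps)^-1 @[eps --> 0^'+] --> (2 * c1)^-1.
  by apply: cvgV => //; rewrite gt_eqF// mulr_gt0.
have := cvgM_right0 (@cvg_cst_right0 _ (C + 1)) (cvgM_right0 id0 hV).
rewrite mul0r mulr0 => h.
suff : tail_flux C eps @[eps --> 0^'+] --> Num.sqrt (0 : R) by rewrite sqrtr0.
apply: (@continuous_cvg _ _ _ _ _ _ (@Num.sqrt R)); first exact: sqrt_continuous.
apply: cvg_trans h; apply: near_eq_cvg; near=> eps.
have e0 : 0 < eps by near: eps; exact: nbhs_right_gt.
have Z0 : 0 < Z H eps by near: eps; exact: partition_gt0.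
by rewrite /=; field; rewrite !gt_eqF.
Unshelve. all: end_near. Qed.

End SmallNoise.

(** * Flux and energy of a solution at a positive time *)

Section Flux.
Context {R : realType} (H : R -> R) (C c eps : R).
Context (rho0 du0 : R -> R) (rho : R -> R -> R).
Hypothesis HH : potential H.
Hypothesis eps0 : 0 < eps.
Hypothesis Z0 : 0 < Z H eps.
Hypothesis ini : initial_data H C c eps rho0 du0.
Hypothesis sol : solution H eps rho0 du0 rho.
Variable t : R.
Hypothesis t0 : 0 < t.

Local Notation g := (gamma H eps).
Local Notation w := (densT H eps rho t).

Lemma gamma_gt0 x : 0 < g x.
Proof. by rewrite mulr_gt0 ?invr_gt0// expR_gt0. Qed.

Lemma rho_dens s x : rho s x = g x * densT H eps rho s x.
Proof. by rewrite /densT /dens mulrCA divff ?mulr1// gt_eqF// gamma_gt0. Qed.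

Lemma is_derive_gamma (x : R) :
  is_derive x 1 g (- (derive1 H x / eps ^+ 2) * g x).
Proof.
have dH : is_derive x 1 H (derive1 H x).
  by rewrite derive1E; apply/derivableP; exact: (@pot_derivable _ _ HH).
have dl : is_derive x 1 (fun y => - (H y / eps ^+ 2)) (- (derive1 H x / eps ^+ 2)).
  by apply: is_derive_eq; rewrite /GRing.scale/= mulr0 add0r mulrC.
have de : is_derive x 1 (boltzmann H eps) (boltzmann H eps x * - (derive1 H x / eps ^+ 2)).
  exact: (is_derive1_comp (is_derive_expR _) dl).
rewrite /gamma; apply: is_derive_eq.
by rewrite /GRing.scale/=; ring.
Qed.

Lemma continuous_gamma : continuous g.
Proof.
move=> x; apply/differentiable_continuous/derivable1_diffP.
by have [] := is_derive_gamma x.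
Qed.

Lemma tau_gt0 : 0 < tau eps.
Proof. by rewrite mulr_gt0 ?expR_gt0// invr_gt0 exprn_gt0. Qed.

Lemma continuous_snd_of_pair (f : R -> R -> R) (x : R) :
  {for (t, x), continuous (fun p : R * R => f p.1 p.2)} -> {for x, continuous (f t)}.
Proof.
move=> h; apply: (@continuous2_cvg _ _ _ _ _ _ (fun=> t) id f t x) => //.
exact: cvg_cst.
Qed.

Lemma dens_time_derivable (x : R) : derivable (fun s => densT H eps rho s x) t 1.
Proof. by have hs := sol_smooth sol; have [dt _ _] := hs [::] t x t0; exact: dt. Qed.

Lemma dens_derivable (x : R) : derivable w x 1.
Proof. by have hs := sol_smooth sol; have [_ dx _] := hs [::] t x t0; exact: dx. Qed.

Lemma dens_derive_derivable (x : R) : derivable (derive1 w) x 1.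
Proof. by have hs := sol_smooth sol; have [_ dx _] := hs [:: false] t x t0; exact: dx. Qed.

Lemma continuous_dens_derive : continuous (derive1 w).
Proof.
move=> x; apply/differentiable_continuous/derivable1_diffP.
exact: dens_derive_derivable.
Qed.

Lemma continuous_dens : continuous w.
Proof.
move=> x; apply/differentiable_continuous/derivable1_diffP; exact: dens_derivable.
Qed.

Lemma dt_rho (x : R) : d_t rho t x = g x * d_t (densT H eps rho) t x.
Proof.
have dt := @dens_time_derivable x.
rewrite /d_t; have -> : (fun s => rho s x) = (fun s => g x * densT H eps rho s x).
  by apply/funext => s; exact: rho_dens.
by rewrite derive1E (derive1E (fun s => densT H eps rho s x)) deriveZ.
Qed.

Lemma continuous_dt_rho : continuous (d_t rho t).
Proof.
have -> : d_t rho t = (fun x => g x * d_t (densT H eps rho) t x).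
  by apply/funext => x; exact: dt_rho.
move=> x; apply: cvgM; first exact: continuous_gamma.
have hs := sol_smooth sol; have [_ _ h] := hs [:: true] t x t0.
exact: (@continuous_snd_of_pair (d_t (densT H eps rho))).
Qed.

(** As [gamma' = - gamma * H' / eps^2], the drift in the equation for [rho]
    combines with [d_x (gamma * w)] into [gamma * d_x w]. *)
Lemma is_derive_flux (x : R) :
  is_derive x 1 (fun y => g y * derive1 w y) (tau eps * d_t rho t x).
Proof.
have E : (fun y => d_x rho t y + eps ^- 2 * rho t y * derive1 H y) =
    (fun y => g y * derive1 w y).
  apply/funext => y.
  have dg := is_derive_gamma y.
  have dw : is_derive y 1 w (derive1 w y).
    by rewrite derive1E; apply/derivableP; exact: (@dens_derivable y).
  have -> : d_x rho t y = - (derive1 H y / eps ^+ 2) * g y * w y + g y * derive1 w y.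
    rewrite /d_x; have -> : rho t = (fun z => g z * w z).
      by apply/funext => z; exact: rho_dens.
    rewrite derive1E; apply: derive_val; apply: is_derive_eq.
    by rewrite /GRing.scale/=; ring.
  by rewrite rho_dens; field; rewrite gt_eqF.
rewrite (sol_pde sol)// E derive1E; apply/derivableP.
apply: derivableM; last exact: dens_derive_derivable.
by have [] := is_derive_gamma x.
Qed.

(** The dissipation identity makes [int gamma (d_x w)^2] at most its initial
    value, which the well-preparedness of the data bounds by [C * tau]. *)
Lemma energy_bound :
  (\int[leb]_x (g x * (derive1 w x) ^+ 2)%:E <= (C * tau eps)%:E)%E.
Proof.
have T0 := tau_gt0.
have sd := sol_dissipation sol t0.
have mdu : measurable_fun [set: measurableTypeR R] du0.
  by have [_ [h _] _] := ini_deriv ini.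
have mg : measurable_fun [set: measurableTypeR R] g.
  exact: continuous_measurable_fun continuous_gamma.
have i0 : (\int[leb]_x (g x * du0 x ^+ 2)%:E <= (C * tau eps)%:E)%E.
  have := ini_bound ini.
  have -> : (\int[leb]_x (g x * du0 x ^+ 2 / tau eps)%:E =
             (tau eps)^-1%:E * \int[leb]_x (g x * du0 x ^+ 2)%:E)%E.
    rewrite -ge0_integralZl//=.
    - by apply: eq_integral => x _; rewrite -EFinM mulrC.
    - by apply/measurable_EFinP; apply: measurable_funM => //; exact: measurable_funX.
    - by move=> x _; rewrite lee_fin mulr_ge0 ?sqr_ge0// ltW// gamma_gt0.
    - by rewrite lee_fin invr_ge0 ltW.
  move=> h; rewrite mulrC EFinM -lee_pdivrMl//; apply: le_trans h.
  apply: leeDr; apply: integral_ge0 => x _.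
  by rewrite lee_fin mulr_ge0 ?sqr_ge0// ltW// gamma_gt0.
have T20 : 0 < (2 * tau eps)^-1 by rewrite invr_gt0 mulr_gt0.
apply: le_trans i0.
rewrite -(@lee_pmul2l _ (2 * tau eps)^-1%:E)// -sd.
apply: leeDl; apply: integral_ge0 => s _; apply: integral_ge0 => x _.
by rewrite lee_fin divr_ge0 ?sqr_ge0// ltW// gamma_gt0.
Qed.

End Flux.

(** * Estimates at a fixed noise level *)

Section Calculus.
Context {R : realType}.

Lemma integral_derivative (F f : R -> R) (a b : R) : a < b ->
  (forall x : R, is_derive x 1 F (f x)) -> continuous f ->
  \int[leb]_(x in `[a, b]) f x = F b - F a.
Proof.
move=> ab dF cf.
have cF : continuous F.
  by move=> x; apply/differentiable_continuous/derivable1_diffP; have [] := dF x.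
rewrite /Rintegral (@continuous_FTC2 _ f F)//.
- exact: continuous_subspaceT.
- split.
  + by move=> x _; have [] := dF x.
  + by apply: cvg_at_right_filter; exact: cF.
  + by apply: cvg_at_left_filter; exact: cF.
- by move=> x _; rewrite derive1E; apply: derive_val.
Qed.

Lemma continuous_integrable_itv (f : R -> R) (a b : R) : continuous f ->
  leb.-integrable `[a, b] (EFin \o f).
Proof.
move=> cf; apply: continuous_compact_integrable; first exact: segment_compact.
exact: continuous_subspaceT.
Qed.

Lemma exists_le_of_integral (f : R -> R) (a K K' : R) : K < K' ->
  (forall x, 0 <= f x) -> (\int[leb]_x (f x)%:E <= K%:E)%E ->
  exists2 b, a <= b <= a + 1 & f b <= K'.
Proof.
move=> KK' f0 fK; apply: contrapT => hn.
suff : (K'%:E <= K%:E)%E by rewrite lee_fin leNgt KK'.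
apply: le_trans fK.
have -> : (K'%:E = \int[leb]_(x in `[a, (a + 1)%R]) K'%:E)%E.
  by rewrite integral_cst//= lebesgue_measure_itv/= lte_fin ltrDl ltr01 -EFinD
    addrAC subrr add0r mule1.
apply: (@le_trans _ _ (\int[leb]_(x in `[a, (a + 1)%R]) (f x)%:E)%E).
  apply: le_integral_nomeas => x; rewrite /= in_itv/= => ab.
  by rewrite lee_fin leNgt; apply/negP => h; apply: hn; exists x => //; exact: ltW.
by apply: ge0_subset_integral_nomeas => // x _; rewrite lee_fin.
Qed.

Lemma ler_dist_sub (p q r s : R) :
  `|p - q - r| <= s -> p - r - s <= q <= p - r + s.
Proof. by rewrite ler_norml => /andP[? ?]; apply/andP; split; lra. Qed.

End Calculus.

Section Estimates.
Context {R : realType} (H : R -> R) (C c eps : R).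
Context (rho0 du0 : R -> R) (rho : R -> R -> R).
Hypothesis HH : potential H.
Hypothesis eps0 : 0 < eps.
Hypothesis Z0 : 0 < Z H eps.
Hypothesis ini : initial_data H C c eps rho0 du0.
Hypothesis sol : solution H eps rho0 du0 rho.
Variable t : R.
Hypothesis t0 : 0 < t.

Local Notation g := (gamma H eps).
Local Notation w := (densT H eps rho t).

Let g0 x : 0 < g x. Proof. exact: gamma_gt0. Qed.
Let cg : continuous g. Proof. exact: continuous_gamma HH. Qed.
Let cw : continuous w.
Proof. exact: (continuous_dens sol t0). Qed.
Let cdw : continuous (derive1 w).
Proof. exact: (continuous_dens_derive sol t0). Qed.
Let dw (x : R) : is_derive x 1 w (derive1 w x).
Proof. by rewrite derive1E; apply/derivableP; exact: (dens_derivable sol t0). Qed.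

(** The weighted inequality in the definition of [oscillation] integrates to
    [lam * C * tau] by the energy bound, and [1 / gamma] is at most
    [Z * exp (h / eps^2)] near a well. *)
Lemma dens_oscillation (h s x y : R) : `|s| = 1 ->
  (forall s x, `|s| = 1 -> `|x - s| <= 2^-1 -> H x <= h) ->
  `|x - s| <= 2^-1 -> `|y - s| <= 2^-1 ->
  `|w x - w y| <= oscillation H C h eps.
Proof.
move=> s1 hh; wlog xy : x y / x < y => [hw|] xs ys.
  have [xy|yx|->] := ltgtP x y; first exact: hw.
    by rewrite distrC; exact: hw.
  (* When [x = y] what remains is the sign of [oscillation]. *)
  apply: le_trans (hw (s - 2^-1) (s + 2^-1) _ _ _); rewrite ?subrr ?normr0//.
  - by lra.
  - by rewrite addrAC subrr add0r normrN gtr0_norm// invr_gt0.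
  - by rewrite addrAC subrr add0r gtr0_norm// invr_gt0.
rewrite distrC -(integral_derivative xy dw cdw).
set lam := expR ((1 + h) / 2 / eps ^+ 2); set m := Z H eps * expR (h / eps ^+ 2).
have lam0 : 0 < lam by exact: expR_gt0.
have m0 : 0 < m by rewrite mulr_gt0 ?expR_gt0.
have ptw z : z \in `[x, y]%R -> `|derive1 w z| <= lam * (g z * derive1 w z ^+ 2) + m / lam.
  rewrite in_itv/= => /andP[xz zy].
  have zs : `|z - s| <= 2^-1.
    move: xs ys; rewrite !ler_norml => /andP[? ?] /andP[? ?]; apply/andP; split; lra.
  have gm : (g z)^-1 <= m.
    rewrite /gamma /boltzmann invfM invrK -expRN opprK ler_pM2l// ler_expR.
    by rewrite ler_pM2r ?invr_gt0 ?exprn_gt0//; exact: (hh s).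
  have p0 : 0 < lam * g z by rewrite mulr_gt0.
  have -> : lam * (g z * derive1 w z ^+ 2) = lam * g z * `|derive1 w z| ^+ 2.
    by rewrite real_normK ?num_real// mulrA.
  have : (lam * g z)^-1 <= m / lam by rewrite invfM mulrC ler_pM2r ?invr_gt0.
  move: (lam * g z) p0 => p p0 hp; move: `|_| => d; move: (m / lam) hp => q hp.
  rewrite -(ler_pM2l p0); have : p * p^-1 <= p * q by rewrite ler_pM2l.
  rewrite mulfV ?gt_eqF//; have := sqr_ge0 (p * d - 1); nra.
have en := energy_bound HH eps0 Z0 ini sol t0.
have mE : measurable_fun [set: measurableTypeR R] (fun z => g z * derive1 w z ^+ 2).
  apply: continuous_measurable_fun => z; apply: cvgM; first exact: cg.
  by apply: (@continuous_comp _ _ _ (derive1 w) (fun u => u ^+ 2));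
    [exact: cdw|exact: sqr_continuous].
have E0 z : 0 <= g z * derive1 w z ^+ 2 by rewrite mulr_ge0 ?sqr_ge0// ltW.
rewrite -lee_fin.
apply: (@le_trans _ _ (\int[leb]_(z in `[x, y]) `|derive1 w z|%R%:E)%E).
  rewrite EFin_normr_Rintegral//; last exact: continuous_integrable_itv.
  apply: le_abse_integral => //.
  by apply/measurable_EFinP/measurable_funTS; exact: continuous_measurable_fun cdw.
apply: (@le_trans _ _ (\int[leb]_(z in `[x, y])
    ((lam * (g z * derive1 w z ^+ 2))%R%:E + (m / lam)%R%:E))%E).
  by apply: ge0_le_integral_nomeas => z zx; rewrite -?EFinD lee_fin// ptw.
rewrite ge0_integralD//; last 3 first.
- by move=> z _; rewrite lee_fin mulr_ge0// ltW.
- by apply/measurable_EFinP/measurable_funTS; exact: measurable_funM.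
- by move=> z _; rewrite lee_fin divr_ge0// ltW.
rewrite /oscillation -/lam -/m EFinD; apply: leeD.
  apply: (@le_trans _ _ (\int[leb]_z (lam * (g z * derive1 w z ^+ 2))%R%:E)%E).
    by apply: ge0_subset_integral_nomeas => // z _; rewrite lee_fin mulr_ge0// ltW.
  under eq_integral do rewrite EFinM.
  rewrite ge0_integralZl//=; last 3 first.
  - exact/measurable_EFinP.
  - by move=> z _; rewrite lee_fin.
  - by rewrite lee_fin ltW.
  by rewrite EFinM lee_pmul2l// lte_fin.
rewrite integral_cst//= lebesgue_measure_itv/= lte_fin xy -EFinD -EFinM lee_fin.
rewrite ler_piMr ?divr_ge0 ?(ltW m0) ?(ltW lam0)//.
move: xs ys; rewrite !ler_norml => /andP[? ?] /andP[? ?]; lra.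
Qed.

(** Since [rho = gamma * w] and [w] is nearly constant near the well, the
    [rho]-mass of the well is nearly [w y] times its [gamma]-mass. *)
Lemma dens_average (h s y : R) : `|s| = 1 ->
  (forall s x, `|s| = 1 -> `|x - s| <= 2^-1 -> H x <= h) -> `|y - s| <= 2^-1 ->
  `| \int[leb]_x (cutoff s x * rho t x) - w y * well_mass H s eps |
    <= oscillation H C h eps * well_mass H s eps.
Proof.
move=> s1 hh ys; rewrite /well_mass.
set m := \int[leb]_(x in `[s - 2^-1, s + 2^-1]) (cutoff s x * g x).
have cont2 (k : R -> R) : continuous k ->
    continuous (fun x => k x * (cutoff s x * g x)).
  move=> ck x; apply: cvgM; first exact: ck.
  by apply: cvgM; [exact: continuous_cutoff|exact: cg].
have int2 (k : R -> R) : continuous k -> leb.-integrable `[s - 2^-1, s + 2^-1]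
    (EFin \o (fun x => k x * (cutoff s x * g x))).
  by move=> ck; apply: continuous_integrable_itv; exact: cont2.
have cc (k : R) : continuous (fun _ : R => k) by move=> x; exact: cvg_cst.
have im : leb.-integrable `[s - 2^-1, s + 2^-1] (EFin \o (fun x => cutoff s x * g x)).
  by have := int2 _ (cc 1); apply: eq_integrable => // x _; rewrite /= mul1r.
have E : \int[leb]_x (cutoff s x * rho t x) =
    \int[leb]_(x in `[s - 2^-1, s + 2^-1]) (w x * (cutoff s x * g x)).
  rewrite [RHS]Rintegral_mkcond; apply: eq_Rintegral => x _; rewrite patchE.
  case: ifPn => [_|]; first by rewrite (rho_dens rho Z0) mulrA mulrC.
  rewrite notin_setE/= in_itv/= => hx; rewrite cutoff_out ?mul0r//.
  rewrite leNgt; apply/negP => xs; apply: hx; move: xs.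
  by rewrite ltr_norml => /andP[? ?]; apply/andP; split; lra.
have Ey : w y * m = \int[leb]_(x in `[s - 2^-1, s + 2^-1]) (w y * (cutoff s x * g x)).
  by rewrite RintegralZl.
rewrite E Ey -RintegralB//; [|exact: int2|exact: (int2 _ (cc (w y)))].
have iB : leb.-integrable `[s - 2^-1, s + 2^-1]
    (EFin \o (fun x => w x * (cutoff s x * g x) - w y * (cutoff s x * g x))).
  have mS : measurable (`[s - 2^-1, s + 2^-1] : set (measurableTypeR R)) by exact: measurable_itv.
  by have := integrableB mS (int2 _ cw) (int2 _ (cc (w y))); apply: eq_integrable.
apply: le_trans (le_normr_Rintegral _ iB) _ => //.
rewrite -RintegralZl//; apply: le_Rintegral => //.
- exact: integrable_norm.
- exact: (int2 _ (cc (oscillation H C h eps))).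
- move=> x; rewrite /= in_itv/= -ler_distl => xs.
  have b0 : 0 <= cutoff s x * g x by rewrite mulr_ge0 ?cutoff_ge0 ?ltW.
  by rewrite -mulrBl normrM (ger0_norm b0) ler_wpM2r// (dens_oscillation s1 hh).
Qed.

Lemma cutoff_mass_le1 (s : R) : `| \int[leb]_x (cutoff s x * rho t x) | <= 1.
Proof.
have r0 x : 0 <= cutoff s x * rho t x.
  by rewrite mulr_ge0 ?cutoff_ge0 ?(sol_ge0 sol)// ltW.
rewrite ger0_norm; last by apply: Rintegral_ge0 => x _.
have h : (\int[leb]_x (cutoff s x * rho t x)%:E <= 1)%E.
  rewrite -(sol_mass sol (ltW t0)); apply: ge0_le_integral_nomeas => x _.
    by rewrite lee_fin.
  by rewrite lee_fin ler_piMl ?cutoff_le1// (sol_ge0 sol)// ltW.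
have h0 : (0 <= \int[leb]_x (cutoff s x * rho t x)%:E)%E.
  by apply: integral_ge0 => x _; rewrite lee_fin.
rewrite -lee_fin /Rintegral fineK// ge0_fin_numE//; exact: le_lt_trans h (ltry _).
Qed.

Lemma tail_flux_small : exists2 b, 2 <= b <= 3 &
  `|g b * derive1 w b / tau eps| <= tail_flux H C eps.
Proof.
have T0 : 0 < tau eps by exact: tau_gt0.
have en := energy_bound HH eps0 Z0 ini sol t0.
have E0 z : 0 <= g z * derive1 w z ^+ 2 by rewrite mulr_ge0 ?sqr_ge0// ltW.
have CC : C * tau eps < (C + 1) * tau eps by rewrite ltr_pM2r// ltrDl.
have [b hb Eb] := @exists_le_of_integral _ _ 2 _ _ CC E0 en.
have b23 : 2 <= b <= 3 by move: hb => /andP[-> /= hb]; lra.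
exists b => //; rewrite /tail_flux -sqrtr_sqr; apply: ler_wsqrtr.
have gb : g b <= (Z H eps)^-1 * expR (- eps ^- 2).
  rewrite /gamma /boltzmann ler_pM2l ?invr_gt0// ler_expR lerN2.
  rewrite -[leLHS]mul1r ler_pM2r ?invr_gt0 ?exprn_gt0//; apply: (pot_ge1 HH).
  by have /andP[] := b23.
have -> : (g b * derive1 w b / tau eps) ^+ 2 =
    g b * (g b * derive1 w b ^+ 2) / tau eps ^+ 2 by field; rewrite gt_eqF.
rewrite ler_pdivrMr ?exprn_gt0//.
apply: le_trans (ler_pM (ltW (g0 b)) (E0 b) gb Eb) _.
rewrite le_eqVlt; apply/orP; left; apply/eqP; rewrite /tau.
by move: (expR _) => X; field; rewrite !gt_eqF.
Qed.

(** For [a] in the barrier and [b] in [[2, 3]], [F b - F a] is the integral of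
    [d_t rho] over [[a, b]], which consists of [J+] and of a part of [Jbar].
    Hence [F a] is nearly independent of [a], and integrating
    [d_x w = tau * F / gamma] over the barrier expresses it by the jump of [w].
    The error [int_Jbar |d_t rho|] may be infinite at exceptional times. *)
Lemma barrier_flux_balance alpha : eps `^ alpha <= 2^-1 -> 0 < resistance H eps ->
  (`| \int[leb]_(x in J alpha 1 eps) d_t rho t x
      + (w 2^-1 - w (- 2^-1)) / (tau eps * resistance H eps) |%R%:E
   <= (tail_flux H C eps)%:E + \int[leb]_(x in Jbar alpha eps) `|d_t rho t x|%R%:E)%E.
Proof.
move=> small; set N := resistance H eps => N0.
have T0 : 0 < tau eps by exact: tau_gt0.
have cr : continuous (d_t rho t).
  exact: (continuous_dt_rho HH Z0 sol t0).
have [b b23 Fb] := tail_flux_small.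
set A := \int[leb]_(x in J alpha 1 eps) d_t rho t x.
pose F x := g x * derive1 w x / tau eps.
have dF (x : R) : is_derive x 1 F (d_t rho t x).
  have dP := is_derive_flux HH eps0 Z0 sol t0 x.
  have -> : F = (fun y => (tau eps)^-1 * (g y * derive1 w y)).
    by apply/funext => y; rewrite /F mulrC.
  have -> : d_t rho t x = (tau eps)^-1 * (tau eps * d_t rho t x).
    by rewrite mulrA mulVf ?mul1r// gt_eqF.
  exact: is_deriveZ.
set D := (\int[leb]_(x in Jbar alpha eps) `|d_t rho t x|%R%:E)%E.
have D0 : (0 <= D)%E by apply: integral_ge0 => x _; rewrite lee_fin.
have sJ : J alpha 1 eps `<=` [set x | 2^-1 <= x <= 2].
  move=> x; rewrite /J /= in_itv/= => /andP[? ?]; apply/andP; split; lra.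
have flux a : - 2^-1 <= a <= 2^-1 -> (`|F b - F a - A|%R%:E <= D)%E.
  move=> /andP[al au]; have ab : a < b by have /andP[? ?] := b23; lra.
  rewrite -(integral_derivative ab dF cr).
  have JU : `[a, b] = J alpha 1 eps `|` (`[a, b] `\` J alpha 1 eps) :> set R.
    rewrite setDUK// => x /sJ/andP[? ?]; rewrite /= in_itv/=.
    by have /andP[? ?] := b23; apply/andP; split; lra.
  have mJ : measurable (J alpha 1 eps : set (measurableTypeR R)) by exact: measurable_itv.
  have mab : measurable (`[a, b] : set (measurableTypeR R)) by exact: measurable_itv.
  have iab := @continuous_integrable_itv _ _ a b cr.
  rewrite [in X in `|X - A|]JU Rintegral_setU//; last 3 first.
  - exact: measurableD.
  - by rewrite -JU.
  - by rewrite disj_set2E setDIK.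
  rewrite addrAC subrr add0r EFin_normr_Rintegral; last 2 first.
  - exact: measurableD.
  - by apply: integrableS iab => //; exact: measurableD.
  apply: le_trans (le_abse_integral _ _ _) _; [exact: measurableD| |].
    by apply/measurable_EFinP/measurable_funTS; exact: continuous_measurable_fun cr.
  apply: ge0_subset_integral_nomeas => [x [/= xab nJ]|x _]; last by rewrite lee_fin.
  move=> [|//]; rewrite /J /= in_itv/= => /andP[? ?]; move: xab; rewrite in_itv/= => /andP[? ?].
  by lra.
have [Dy|Dfin] := eqVneq D +oo%E; first by rewrite Dy addey// leey.
have {}Dfin : D \is a fin_num by rewrite ge0_fin_numE// lt_neqAle Dfin leey.
rewrite -(fineK Dfin) in flux *; move: (fine D) flux => d flux.
rewrite -EFinD lee_fin.
have ig : leb.-integrable `[- 2^-1, 2^-1] (EFin \o (fun x => (g x)^-1)).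
  apply: continuous_integrable_itv => x; apply: cvgV; first by rewrite gt_eqF.
  exact: cg.
have igZ k : leb.-integrable `[- 2^-1, 2^-1] (EFin \o (fun x => k * (g x)^-1)).
  apply: continuous_integrable_itv => x; apply: cvgM; first exact: cvg_cst.
  by apply: cvgV; [rewrite gt_eqF|exact: cg].
have half : - 2^-1 < 2^-1 :> R by lra.
have wE := integral_derivative half dw cdw.
have up : w 2^-1 - w (- 2^-1) <= tau eps * (F b - A + d) * N.
  rewrite -wE /N /resistance -RintegralZl//; apply: le_Rintegral => //.
  - exact: continuous_integrable_itv.
  - move=> x; rewrite /= in_itv/= => hx; have := flux x hx.
    rewrite lee_fin => /ler_dist_sub/andP[_ h1].
    rewrite ler_pdivlMr//.
    have -> : derive1 w x * g x = tau eps * F x by rewrite /F; field; rewrite gt_eqF.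
    by rewrite ler_pM2l.
have lo : tau eps * (F b - A - d) * N <= w 2^-1 - w (- 2^-1).
  rewrite -wE /N /resistance -RintegralZl//; apply: le_Rintegral => //.
  - exact: continuous_integrable_itv.
  - move=> x; rewrite /= in_itv/= => hx; have := flux x hx.
    rewrite lee_fin => /ler_dist_sub/andP[h1 _].
    rewrite ler_pdivrMr//.
    have -> : derive1 w x * g x = tau eps * F x by rewrite /F; field; rewrite gt_eqF.
    by rewrite ler_pM2l.
have TN0 : 0 < tau eps * N by rewrite mulr_gt0.
have up' : (w 2^-1 - w (- 2^-1)) / (tau eps * N) <= F b - A + d.
  by rewrite ler_pdivrMr// mulrC mulrAC.
have lo' : F b - A - d <= (w 2^-1 - w (- 2^-1)) / (tau eps * N).
  by rewrite ler_pdivlMr// mulrC mulrAC.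
move: Fb up' lo'; rewrite -/(F b) !ler_norml; move: (F b) (_ / _) (tail_flux _ _ _) => p q r.
move=> /andP[? ?] ? ?; apply/andP; split; lra.
Qed.

End Estimates.

(** * Square-integrable functions *)

Section SquareIntegrable.
Context {R : realType}.
Implicit Types (D : set (measurableTypeR R)) (f g : R -> R).

Lemma ler_mul_sqrD (x y : R) : x * y <= x ^+ 2 + y ^+ 2.
Proof. by have := sqr_ge0 (x - y); have := sqr_ge0 (x + y); nra. Qed.

Lemma L2_integrable_sqr D f : measurable D -> L2 D f ->
  leb.-integrable D (EFin \o (fun x => f x ^+ 2)).
Proof.
move=> mD [mf ff]; apply/integrableP; split.
  by apply/measurable_EFinP; exact: measurable_funX.
by under eq_integral do rewrite /= ger0_norm ?sqr_ge0//.
Qed.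

Lemma integrable_sqr_L2 D f : measurable_fun D f ->
  leb.-integrable D (EFin \o (fun x => f x ^+ 2)) -> L2 D f.
Proof.
move=> mf /integrableP[_ h]; split => //; apply: le_lt_trans h.
by apply: ge0_le_integral_nomeas => x _; rewrite lee_fin ?sqr_ge0//= ger0_norm ?sqr_ge0.
Qed.

Lemma L2S (D D' : set (measurableTypeR R)) f : measurable D -> measurable D' -> D' `<=` D ->
  L2 D f -> L2 D' f.
Proof.
move=> mD mD' DD' h; apply: integrable_sqr_L2.
  by have [mf _] := h; exact: measurable_funS mf.
by apply: integrableS (L2_integrable_sqr mD h).
Qed.

Lemma L2_mul_integrable D f g : measurable D -> L2 D f -> L2 D g ->
  leb.-integrable D (EFin \o (fun x => f x * g x)).
Proof.
move=> mD hf hg; have [mf _] := hf; have [mg _] := hg.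
apply: (le_integrable mD _ _ (integrableD mD (L2_integrable_sqr mD hf) (L2_integrable_sqr mD hg))).
  by apply/measurable_EFinP; exact: measurable_funM.
move=> x _; rewrite /= lee_fin [leRHS]ger0_norm ?addr_ge0 ?sqr_ge0//.
by rewrite ler_norml; apply/andP; split; nra.
Qed.

Lemma L2D D f g : measurable D -> L2 D f -> L2 D g -> L2 D (fun x => f x + g x).
Proof.
move=> mD hf hg; have [mf _] := hf; have [mg _] := hg.
have mfg : measurable_fun D (fun x => f x + g x) by exact: measurable_funD.
apply: (integrable_sqr_L2 mfg).
have i2 h : L2 D h -> leb.-integrable D (EFin \o (fun x => 2 * h x ^+ 2)).
  move=> hh; have := @integrableZl _ _ R leb D mD 2 _ (L2_integrable_sqr mD hh).
  by apply: eq_integrable.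
apply: (le_integrable mD _ _ (integrableD mD (i2 _ hf) (i2 _ hg))).
  by apply/measurable_EFinP; exact: measurable_funX.
move=> x _; rewrite /= lee_fin (ger0_norm (sqr_ge0 _)) ger0_norm; last first.
  by apply: addr_ge0; apply: mulr_ge0; rewrite ?sqr_ge0.
by have := sqr_ge0 (f x - g x); nra.
Qed.

Lemma L2Z D (k : R) f : measurable D -> L2 D f -> L2 D (fun x => k * f x).
Proof.
move=> mD hf; have [mf _] := hf.
apply: integrable_sqr_L2; first exact: measurable_funM.
have := @integrableZl _ _ R leb D mD (k ^+ 2) _ (L2_integrable_sqr mD hf).
by apply: eq_integrable => // x _; rewrite /= exprMn.
Qed.

Lemma L2_bounded D f (M : R) : measurable D -> (leb D < +oo)%E ->
  measurable_fun D f -> (forall x, D x -> `|f x| <= M) -> L2 D f.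
Proof.
move=> mD fD mf fM; apply: (integrable_sqr_L2 mf).
apply: (@measurable_bounded_integrable _ _ R leb) => //; first exact: measurable_funX.
exists (M ^+ 2); split; first exact: num_real.
move=> y My x Dx; apply: le_trans (ltW My).
by rewrite /= normrX ler_pXn2r ?nnegrE ?(le_trans _ (fM x Dx))//; exact: fM.
Qed.

Lemma L2_abs D f : L2 D f -> L2 D (fun x => `|f x|).
Proof.
move=> [mf hf]; split; first exact: measurableT_comp.
by under eq_integral do rewrite real_normK ?num_real//.
Qed.

End SquareIntegrable.

(** * Weak and pointwise limits *)

Section Identification.
Context {R : realType} (T : R).
Local Notation I := (`]0, T] : set (measurableTypeR R)).

(** Test both limits against [g = a - b]: the integrals of [A n * g] and
    [B n * g] have the same limit because their difference is small by the
    inequality [|g| q <= eta g^2 + q^2 / eta], where [q] is the part of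
    [|A n - B n|] above [M n].  That truncation is measurable and dominated by
    [D n], which itself may fail to be.  The half-open interval leaves out the
    initial time, where the equation gives no information. *)
Lemma weak_pointwise_limit (A B : nat -> R -> R) (D : nat -> R -> \bar R)
    (M : nat -> R) (a b : R -> R) (K : R) :
  weakL2_cvg `[0, T] A a -> L2 `[0, T] b ->
  (forall n, measurable_fun I (B n)) ->
  (forall t, I t -> B n t @[n --> \oo] --> b t) ->
  (\forall n \near \oo, forall t, I t -> `|B n t| <= K) ->
  M n @[n --> \oo] --> (0 : R) ->
  (forall n t, (0 <= D n t)%E) ->
  (\int[leb]_(t in `[0%R, T]) (D n t) ^+ 2)%E @[n --> \oo] --> 0%E ->
  (\forall n \near \oo, forall t, I t ->
     (`|A n t - B n t|%R%:E <= (M n)%:E + D n t)%E) ->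
  (\int[leb]_(t in I) ((a t - b t) ^+ 2)%:E = 0)%E.
Proof.
move=> [A2 a2 Aw] b2 mB Bb BK M0 D0 DL AB.
have mI : measurable I by exact: measurable_itv.
have mI' : measurable (`[0, T] : set (measurableTypeR R)) by exact: measurable_itv.
have II' : I `<=` `[0, T] by exact: subset_itv_oc_cc.
have fI : (leb I < +oo)%E.
  rewrite lebesgue_measure_itv/= lte_fin; case: ifPn => _; last exact: ltry.
  by rewrite -EFinD ltry.
have toI f : L2 `[0, T] f -> L2 I f by exact: L2S.
pose g t := a t - b t.
have g2' : L2 `[0, T] g.
  have := L2D mI' a2 (L2Z (-1) mI' b2).
  by congr (L2 _ _); apply/funext => t; rewrite mulN1r.
have g2 := toI _ g2'.
have mg : measurable_fun I g by have [] := g2.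
have mA n : measurable_fun I (A n) by have [] := toI _ (A2 n).
have iAg n : leb.-integrable I (EFin \o (fun t => A n t * g t)).
  exact: L2_mul_integrable (toI _ (A2 n)) g2.
have iag : leb.-integrable I (EFin \o (fun t => a t * g t)).
  exact: L2_mul_integrable (toI _ a2) g2.
have ibg : leb.-integrable I (EFin \o (fun t => b t * g t)).
  exact: L2_mul_integrable (toI _ b2) g2.
have ig : leb.-integrable I (EFin \o (fun t => `|g t|)).
  have c2 : L2 I (fun=> 1 : R).
    by apply: (@L2_bounded _ _ _ 1) => // t _; rewrite normr1.
  have := L2_mul_integrable mI c2 (L2_abs g2).
  by apply: eq_integrable => // t _; rewrite /= mul1r.
have ig2 := L2_integrable_sqr mI g2.
have B2 : \forall n \near \oo, L2 I (B n).
  by near=> n; apply: (@L2_bounded _ _ _ K) => //; near: n.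
have limA : \int[leb]_(t in I) (A n t * g t) @[n --> \oo] --> \int[leb]_(t in I) (a t * g t).
  have := Aw g g2'; rewrite -(Rintegral_itv_obnd_cbnd iag).
  by under eq_fun do rewrite -(Rintegral_itv_obnd_cbnd (iAg _)).
have limB : \int[leb]_(t in I) (B n t * g t) @[n --> \oo] --> \int[leb]_(t in I) (b t * g t).
  (* The domination holds only from some rank on, so the sequence is shifted. *)
  have [n0 _ Hn0] := BK.
  rewrite -(cvg_shiftn n0) /Rintegral; apply: fine_cvg.
  rewrite fineK; last exact: integrable_fin_num.
  apply: (@dominated_cvg _ _ R leb I mI
     (fun n t => (B (n + n0) t * g t)%:E) (fun t => (b t * g t)%:E)
     (fun t => (K * `|g t|)%:E)).
  - by move=> n; apply/measurable_EFinP; exact: measurable_funM.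
  - move=> t It; apply: cvg_EFin; first exact: nearW.
    apply: cvgMl.
    by rewrite (cvg_shiftn n0 (fun n => B n t)); exact: Bb.
  - by move=> t It; rewrite fin_numE.
  - have := @integrableZl _ _ R leb I mI K _ ig.
    by apply: eq_integrable.
  - move=> n t It; rewrite abse_EFin lee_fin normrM ler_wpM2r//; apply: Hn0 => //=.
    exact: leq_addl.
have limAB : (fun n => \int[leb]_(t in I) (A n t * g t) - \int[leb]_(t in I) (B n t * g t)) n
    @[n --> \oo] --> (0 : R).
  pose G1 := \int[leb]_(t in I) `|g t|; pose G2 := \int[leb]_(t in I) g t ^+ 2.
  have G10 : 0 <= G1 by apply: Rintegral_ge0.
  have G20 : 0 <= G2 by apply: Rintegral_ge0 => t _; exact: sqr_ge0.
  apply/cvgrPdist_le => /= d d0.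
  pose eta := d / (3 * (G2 + 1)).
  have eta0 : 0 < eta by rewrite divr_gt0// mulr_gt0// ltr_wpDl.
  have etaG : eta * G2 <= d / 3.
    rewrite /eta mulrAC ler_pdivrMr ?mulr_gt0// ?ltr_wpDl//.
    by have -> : d / 3 * (3 * (G2 + 1)) = d * (G2 + 1) by [field]; rewrite ler_pM2l// lerDl.
  have edn : nbhs 0%E [set x : \bar R | (x < (eta * d / 3)%:E)%E].
    apply: open_nbhs_nbhs; split; first exact: open_ereal_lt_ereal.
    by rewrite /= lte_fin divr_gt0// mulr_gt0.
  near=> n.
  have MG : `|M n| * G1 <= d / 3.
    have h : `|0 - M n| <= d / (3 * (G1 + 1)).
      by near: n; move/cvgrPdist_le : M0; apply; rewrite divr_gt0// mulr_gt0// ltr_wpDl.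
    rewrite sub0r normrN in h; apply: le_trans (ler_wpM2r G10 h) _.
    rewrite mulrAC ler_pdivrMr ?mulr_gt0// ?ltr_wpDl//.
    by have -> : d / 3 * (3 * (G1 + 1)) = d * (G1 + 1) by [field]; rewrite ler_pM2l// lerDl.
  have DLn : (\int[leb]_(t in `[0%R, T]) (D n t) ^+ 2 <= (eta * d / 3)%:E)%E.
    by apply/ltW; near: n; exact: (DL _ edn).
  have ABn : forall t, I t -> (`|A n t - B n t|%R%:E <= (M n)%:E + D n t)%E by near: n.
  have B2n : L2 I (B n) by near: n.
  pose q t := Num.max (`|A n t - B n t| - M n) 0.
  have q0 t : 0 <= q t by rewrite le_max lexx orbT.
  have mq : measurable_fun I q.
    apply: measurable_maxr => //; apply: measurable_funB => //.
    by apply: measurableT_comp => //; exact: measurable_funB.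
  have qD t : I t -> ((q t ^+ 2)%:E <= (D n t) ^+ 2)%E.
    move=> It; have h : ((q t)%:E <= D n t)%E.
      rewrite /q EFin_max ge_max D0 andbT EFinB leeBlDl//; exact: ABn.
    by rewrite expr2 EFinM expe2; apply: lee_pmul; rewrite ?lee_fin.
  have qI : (\int[leb]_(t in I) (q t ^+ 2)%:E <= (eta * d / 3)%:E)%E.
    apply: le_trans DLn.
    apply: (@le_trans _ _ (\int[leb]_(t in I) (D n t) ^+ 2)%E).
      by apply: ge0_le_integral_nomeas => t It; [rewrite lee_fin sqr_ge0|exact: qD].
    apply: ge0_subset_integral_nomeas => // t _; exact: sqre_ge0.
  have iq : leb.-integrable I (EFin \o (fun t => q t ^+ 2)).
    apply: L2_integrable_sqr => //; split => //; exact: le_lt_trans qI (ltry _).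
  have iBg : leb.-integrable I (EFin \o (fun t => B n t * g t)).
    exact: L2_mul_integrable.
  have i1 : leb.-integrable I (EFin \o (fun t => `|M n| * `|g t|)).
    by have := @integrableZl _ _ R leb I mI `|M n| _ ig; apply: eq_integrable.
  have i2 : leb.-integrable I (EFin \o (fun t => eta * g t ^+ 2)).
    by have := @integrableZl _ _ R leb I mI eta _ ig2; apply: eq_integrable.
  have i3 : leb.-integrable I (EFin \o (fun t => eta^-1 * q t ^+ 2)).
    by have := @integrableZl _ _ R leb I mI eta^-1 _ iq; apply: eq_integrable.
  have i12 : leb.-integrable I (EFin \o (fun t => `|M n| * `|g t| + eta * g t ^+ 2)).
    by have := integrableD mI i1 i2; apply: eq_integrable.
  have i123 : leb.-integrable I
      (EFin \o (fun t => `|M n| * `|g t| + eta * g t ^+ 2 + eta^-1 * q t ^+ 2)).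
    by have := integrableD mI i12 i3; apply: eq_integrable.
  have ptw t : `|A n t * g t - B n t * g t| <= `|M n| * `|g t| + eta * g t ^+ 2 + eta^-1 * q t ^+ 2.
    rewrite -mulrBl normrM.
    have h1 : `|A n t - B n t| <= `|M n| + q t.
      rewrite /q -lerBlDl le_max; apply/orP; left.
      by rewrite lerD2l lerN2 ler_norm.
    apply: le_trans (ler_wpM2r (normr_ge0 _) h1) _; rewrite mulrDl -addrA lerD2l.
    rewrite -(real_normK (num_real (g t))).
    move: `|g t| (q t) (q0 t) (normr_ge0 (g t)) => x y y0 x0.
    rewrite -(ler_pM2l eta0) [y * x]mulrC mulrA; apply: le_trans (ler_mul_sqrD (eta * x) y) _.
    by rewrite le_eqVlt; apply/orP; left; apply/eqP; field; rewrite gt_eqF.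
  rewrite sub0r normrN -RintegralB//.
  apply: le_trans (le_normr_Rintegral _ _) _ => //.
    by have := integrableB mI (iAg n) iBg; apply: eq_integrable.
  apply: (@le_trans _ _ (\int[leb]_(t in I)
    (`|M n| * `|g t| + eta * g t ^+ 2 + eta^-1 * q t ^+ 2))).
    apply: le_Rintegral => //.
    by apply: integrable_norm; have := integrableB mI (iAg n) iBg; apply: eq_integrable.
  rewrite RintegralD// RintegralD// !RintegralZl//.
  have qr : eta^-1 * \int[leb]_(t in I) q t ^+ 2 <= d / 3.
    rewrite ler_pdivrMl// mulrA -lee_fin /Rintegral fineK//; exact: integrable_fin_num.
  by rewrite [leRHS](_ : d = d / 3 + d / 3 + d / 3); [rewrite !lerD|field].
have E : \int[leb]_(t in I) (a t * g t) - \int[leb]_(t in I) (b t * g t) = 0.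
  have h : (fun n => \int[leb]_(t in I) (A n t * g t) - \int[leb]_(t in I) (B n t * g t)) n
    @[n --> \oo] --> \int[leb]_(t in I) (a t * g t) - \int[leb]_(t in I) (b t * g t) by exact: cvgB.
  by rewrite -(cvg_lim (@Rhausdorff R) h) (cvg_lim (@Rhausdorff R) limAB).
have Eg : \int[leb]_(t in I) g t ^+ 2 = 0.
  rewrite -[RHS]E -RintegralB//; apply: eq_Rintegral => t _.
  by rewrite /g -mulrBl expr2.
have := integrable_fin_num mI ig2 => /fineK <-; congr EFin; exact: Eg.
Unshelve. all: end_near. Qed.
End Identification.

(** * The rate minimising the functional *)

Lemma kconst_gt0 (R : realType) (H : R -> R) : potential H -> 0 < kconst H.
Proof.
move=> HH; have [k0 k1 _] := pot_curv HH.
by rewrite mulr_gt0 ?invr_gt0 ?pi_gt0// sqrtr_gt0 mulr_gt0// normr_gt0 lt_eqF.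
Qed.

Lemma ln_slope_gt0 (R : realType) (u : R) : 0 < u < 2 -> u != 1 ->
  0 < ln (u / (2 - u)) / (u - 1).
Proof.
move=> /andP[u0 u2] u1; have v0 : 0 < 2 - u by rewrite subr_gt0.
have [ul|uu|ue] := ltgtP u 1; last by rewrite ue eqxx in u1.
- rewrite nmulr_lgt0 ?invr_lt0 ?subr_lt0//.
  by apply: ln_lt0; rewrite divr_gt0// ltr_pdivrMr//=; lra.
- by rewrite divr_gt0 ?subr_gt0// ln_gt0// ltr_pdivlMr//; lra.
Qed.

(** The difference of the two sides is
    [c / (4 k) * (v + k (u - 1))^2] with [c = ln (u / (2 - u)) / (u - 1) > 0];
    at [u = 1] it is [v^2 / (2 k)]. *)
Lemma minimal_rate (R : realType) (H : R -> R) (u v : R) : potential H -> 0 < u < 2 ->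
  2^-1 * gmet H u (kconst H * (1 - u)) (kconst H * (1 - u)) + DE u (kconst H * (1 - u))
    <= 2^-1 * gmet H u v v + DE u v.
Proof.
move=> HH u02; have k0 := kconst_gt0 HH; set k := kconst H in k0 *.
rewrite /gmet /DE -/k; have [->|u1] := eqVneq u 1.
  have -> : 1 / (2 - 1) = 1 :> R by field.
  rewrite ln1 !mulr0 !addr0 subrr !mulr0 mul0r mulr0.
  by rewrite mulr_ge0 ?invr_ge0// divr_ge0 ?(ltW k0)// -expr2 sqr_ge0.
have u10 : u - 1 != 0 by rewrite subr_eq0.
have := ln_slope_gt0 u02 u1; set L := ln _ => c0.
rewrite -subr_ge0.
set rhs := (X in 0 <= X).
have -> : rhs = L / (u - 1) / (4 * k) * (v + k * (u - 1)) ^+ 2.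
  by rewrite /rhs; field; rewrite u10 gt_eqF.
by rewrite mulr_ge0 ?sqr_ge0// divr_ge0 ?ltW// mulr_gt0.
Qed.

(** * Passage to the limit *)

Section Limit.
Context {R : realType} (H : R -> R) (eps0 C c alpha T : R)
    (rho0 du0 : R -> R -> R) (rho : R -> R -> R -> R)
    (e : nat -> R) (u du : R -> R).
Hypothesis HH : potential H.
Hypothesis eps0_gt0 : 0 < eps0.
Hypothesis H_int : forall eps, 0 < eps <= eps0 ->
       leb.-integrable [set: R] (EFin \o boltzmann H eps).
Hypothesis Hini : forall eps, 0 < eps <= eps0 ->
       initial_data H C c eps (rho0 eps) (du0 eps).
Hypothesis Hsol : forall eps, 0 < eps <= eps0 ->
       solution H eps (rho0 eps) (du0 eps) (rho eps).
Hypothesis alpha_gt0 : 0 < alpha.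
Hypothesis e_range : forall n, 0 < e n <= eps0.
Hypothesis e_lim : e n @[n --> \oo] --> 0.
Hypothesis Hlim : limit_of alpha T e rho u du.

Let I1 : leb.-integrable [set: R] (EFin \o boltzmann H eps0).
Proof. by apply: H_int; rewrite eps0_gt0 lexx. Qed.

Let e0 n : 0 < e n. Proof. by have /andP[] := e_range n. Qed.

Lemma along_sequence : e n @[n --> \oo] --> (0 : R)^'+.
Proof.
move=> A [r /= r0 HA].
move/cvgrPdist_lt : e_lim => /(_ r r0) [N _ hN].
by exists N => // n /hN h; apply: HA.
Qed.

Let seq_cvg (f : R -> R) (l : R) : f eps @[eps --> 0^'+] --> l ->
  f (e n) @[n --> \oo] --> l.
Proof. by move=> h; apply: (cvg_comp _ _ along_sequence h). Qed.

Let Z0 : \forall n \near \oo, 0 < Z H (e n).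
Proof. exact: along_sequence (partition_gt0 HH eps0_gt0 I1). Qed.

Local Notation w := (fun n => densT H (e n) (rho (e n))).

(** The value of [w] near a well is pinned down by the average of [rho] against
    the cutoff, whose limit is prescribed.  The limit is written with the values
    of the cutoff at [1] and [-1], which are [0] or [1], to treat both wells at
    once. *)
Lemma dens_near_well s t y : `|s| = 1 -> 0 < t <= T -> `|y - s| <= 2^-1 ->
  w n t y @[n --> \oo] --> u t * cutoff s 1 + (2 - u t) * cutoff s (-1).
Proof.
move=> s1 /andP[t0 tT] ys.
have [h h1 hh] := pot_wells_below_barrier HH.
have tI : t \in `[0, T] by rewrite inE/= in_itv/= ltW.
have la := lim_rho Hlim tI (C0_cutoff s).
have lm := seq_cvg (well_mass_cvg HH eps0_gt0 I1 s1).
have lo := seq_cvg (oscillation_cvg0 HH eps0_gt0 I1 C h1).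
set L := 2^-1 * _ in la.
have -> : u t * cutoff s 1 + (2 - u t) * cutoff s (-1) = L / 2^-1 by rewrite /L; field.
pose q n := (\int[leb]_x (cutoff s x * rho (e n) t x)) / well_mass H s (e n).
have lq : q n @[n --> \oo] --> L / 2^-1.
  by apply: cvgM => //; apply: cvgV.
have lqo : (fun n => q n - oscillation H C h (e n)) n @[n --> \oo] --> L / 2^-1.
  by rewrite -[X in _ --> X]subr0; apply: cvgB.
have lqo' : (fun n => q n + oscillation H C h (e n)) n @[n --> \oo] --> L / 2^-1.
  by rewrite -[X in _ --> X]addr0; apply: cvgD.
apply: (squeeze_cvgr _ lqo lqo'); near=> n.
have Zn : 0 < Z H (e n) by near: n.
have mn : 0 < well_mass H s (e n) by near: n; apply: (cvgr_gt _ lm).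
have := dens_average HH (e0 n) Zn (Hini (e_range n)) (Hsol (e_range n)) t0 s1 hh ys.
have -> : \int[leb]_x (cutoff s x * rho (e n) t x) = q n * well_mass H s (e n).
  by rewrite /q divfK// gt_eqF.
rewrite -mulrBl normrM (gtr0_norm mn) ler_pM2r// ler_norml => /andP[? ?].
by apply/andP; split; lra.
Unshelve. all: end_near. Qed.

(** Uniformly in time: the [rho]-mass is at most [1], the [gamma]-mass of the well
    exceeds [1/4] and the oscillation is at most [1], whence the bound [4 + 1]. *)
Lemma dens_bounded s y : `|s| = 1 -> `|y - s| <= 2^-1 ->
  \forall n \near \oo, forall t, 0 < t -> `|w n t y| <= 5.
Proof.
move=> s1 ys.
have [h h1 hh] := pot_wells_below_barrier HH.
have lm := seq_cvg (well_mass_cvg HH eps0_gt0 I1 s1).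
have lo := seq_cvg (oscillation_cvg0 HH eps0_gt0 I1 C h1).
near=> n => t t0.
have Zn : 0 < Z H (e n) by near: n.
have mn : 4^-1 < well_mass H s (e n) by near: n; apply: (cvgr_gt _ lm); lra.
have on : oscillation H C h (e n) < 1 by near: n; apply: (cvgr_lt _ lo).
have m0 : 0 < well_mass H s (e n) by exact: lt_trans mn.
have := dens_average HH (e0 n) Zn (Hini (e_range n)) (Hsol (e_range n)) t0 s1 hh ys.
have := cutoff_mass_le1 (Hsol (e_range n)) t0 s.
move: (Rintegral _ _ _) (w n t y) (well_mass _ _ _) (oscillation _ _ _ _) mn on m0.
move=> a x m o mn on m0 ha hx.
rewrite -(ler_pM2r m0) -{1}(gtr0_norm m0) -normrM.
have -> : x * m = a - (a - x * m) by ring.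
apply: le_trans (ler_normB _ _) _.
apply: le_trans (lerD ha hx) _.
by nra.
Unshelve. all: end_near. Qed.

Lemma dens_time_measurable n y :
  measurable_fun (`]0, T] : set (measurableTypeR R)) (fun t => w n t y).
Proof.
apply: (@measurable_funS _ _ _ _ (`]0, +oo[ : set (measurableTypeR R))) => //.
  by apply: subset_itvl; rewrite bnd_simp.
apply: open_continuous_measurable_fun; first exact: interval_open.
move=> t; rewrite inE/= in_itv/= andbT => t0.
apply/differentiable_continuous/derivable1_diffP.
exact: (@dens_time_derivable _ _ _ _ _ _ (Hsol (e_range n)) t t0 y).
Qed.

Hypothesis T_gt0 : 0 < T.
Hypothesis u_cont : {within `[0, T], continuous u}.
Hypothesis Hbound : exists2 cs : R, 0 < cs < 2 &
       forall t, t \in `[0, T] -> cs <= u t <= 2 - cs.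

Let B n t := - ((w n t 2^-1 - w n t (- 2^-1)) / (tau (e n) * resistance H (e n))).

(** The reaction equation.  The mass rate of [J+] converges weakly to
    [du / 2]; the barrier flux [B], computed from the jump of [w] and the
    resistance, converges to [- (2 u - 2) / (4 / k) = k (1 - u) / 2]. *)
Lemma limit_ode :
  (\int[leb]_(t in `]0%R, T]) ((2^-1 * du t - 2^-1 * (kconst H * (1 - u t))) ^+ 2)%:E = 0)%E.
Proof.
have k0 := kconst_gt0 HH.
have lr := seq_cvg (resistance_asymptotics HH eps0_gt0 I1).
have n1 : `|1 : R| = 1 by rewrite normr1.
have n1' : `|-1 : R| = 1 by rewrite normrN normr1.
have hp : `|2^-1 - 1 : R| <= 2^-1 by rewrite ler_norml; apply/andP; split; lra.
have hm : `|- 2^-1 - -1 : R| <= 2^-1 by rewrite ler_norml; apply/andP; split; lra.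
have b11 : cutoff 1 1 = 1 :> R by rewrite cutoff_in// subrr normr0 invr_ge0.
have b1m : cutoff 1 (-1) = 0 :> R.
  by rewrite cutoff_out// -opprD normrN ger0_norm; lra.
have bm1 : cutoff (-1) 1 = 0 :> R by rewrite cutoff_out// ger0_norm; lra.
have bmm : cutoff (-1) (-1) = 1 :> R by rewrite cutoff_in// subrr normr0 invr_ge0.
have mI : measurable (`[0, T] : set (measurableTypeR R)) by exact: measurable_itv.
have mu : measurable_fun (`[0, T] : set (measurableTypeR R)) u.
  exact: subspace_continuous_measurable_fun.
have res_near : \forall n \near \oo, (kconst H)^-1 < tau (e n) * resistance H (e n).
  apply: (cvgr_gt _ lr); rewrite -[ltLHS]mul1r ltr_pM2r ?invr_gt0//; lra.
have radius_near : \forall n \near \oo, e n `^ alpha <= 2^-1.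
  have r0 : 0 < (2^-1 : R) `^ alpha^-1 by rewrite powR_gt0// invr_gt0.
  near=> n.
  have en : e n <= 2^-1 `^ alpha^-1 by near: n; apply: (cvgr_le _ e_lim).
  have -> : 2^-1 = (2^-1 `^ alpha^-1) `^ alpha :> R.
    by rewrite -powRrM mulVf ?gt_eqF// powRr1// invr_ge0.
  by apply: ge0_ler_powR => //; [exact: ltW|rewrite nnegrE ltW|rewrite nnegrE ltW].
apply: (@weak_pointwise_limit _ T
  (fun n t => \int[leb]_(x in J alpha 1 (e n)) d_t (rho (e n)) t x) B
  (fun n t => \int[leb]_(x in Jbar alpha (e n)) `|d_t (rho (e n)) t x|%R%:E)%E
  (fun n => tail_flux H C (e n)) (fun t => 2^-1 * du t)
  (fun t => 2^-1 * (kconst H * (1 - u t))) (10 * kconst H)).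
- exact: lim_dt_Jp Hlim.
- have [cs /andP[cs0 cs2] hu] := Hbound.
  apply: (@L2_bounded _ _ _ (2^-1 * (kconst H * 1))) => //.
  + by rewrite lebesgue_measure_itv/= lte_fin T_gt0 -EFinD ltry.
  + apply: measurable_funM => //; apply: measurable_funM => //; exact: measurable_funB.
  + move=> t tI; rewrite normrM ger0_norm ?invr_ge0// ler_pM2l ?invr_gt0//.
    rewrite normrM gtr0_norm// ler_pM2l// ler_norml.
    by have /andP[? ?] := hu t (mem_set tI); apply/andP; split; lra.
- move=> n; apply: measurableT_comp => //; apply: measurable_funM => //.
  by apply: measurable_funB; exact: dens_time_measurable.
- move=> t; rewrite /= in_itv/= => tI.
  have lp := dens_near_well n1 tI hp; have lm := dens_near_well n1' tI hm.
  have -> : 2^-1 * (kconst H * (1 - u t)) = - ((u t * cutoff 1 1 + (2 - u t) * cutoff 1 (-1)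
     - (u t * cutoff (-1) 1 + (2 - u t) * cutoff (-1) (-1))) / (4 / kconst H)).
    by rewrite b11 b1m bm1 bmm; field; rewrite gt_eqF.
  apply: cvgN; apply: cvgM; first exact: cvgB.
  by apply: cvgV => //; rewrite gt_eqF// divr_gt0.
- have bp := dens_bounded n1 hp; have bm := dens_bounded n1' hm.
  near=> n => t; rewrite /= in_itv/= => /andP[t0 _].
  have rn : (kconst H)^-1 < tau (e n) * resistance H (e n) by near: n.
  have wp : `|w n t 2^-1| <= 5 by move: t t0; near: n.
  have wm : `|w n t (- 2^-1)| <= 5 by move: t t0 {wp}; near: n.
  have r0 : 0 < tau (e n) * resistance H (e n) by apply: lt_trans rn; rewrite invr_gt0.
  rewrite /B normrN normrM normfV (gtr0_norm r0) ler_pdivrMr//.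
  apply: le_trans (ler_normB _ _) _; apply: le_trans (lerD wp wm) _.
  rewrite -mulrA; have : kconst H * (kconst H)^-1 <= kconst H * (tau (e n) * resistance H (e n)).
    by rewrite ler_pM2l// ltW.
  by rewrite mulfV ?gt_eqF//; move: (_ * _) => z; lra.
- exact: seq_cvg (tail_flux_cvg0 HH eps0_gt0 I1 C).
- by move=> n t; apply: integral_ge0 => x _; rewrite lee_fin.
- exact: lim_dt_Jbar Hlim.
- near=> n => t; rewrite /= in_itv/= => /andP[t0 _].
  have Zn : 0 < Z H (e n) by near: n.
  rewrite /B opprK.
  apply: (barrier_flux_balance HH (e0 n) Zn (Hini (e_range n)) (Hsol (e_range n)) t0).
    by near: n.
  have rn : (kconst H)^-1 < tau (e n) * resistance H (e n) by near: n.
  by rewrite -(pmulr_rgt0 _ (tau_gt0 (e0 n))) (lt_trans _ rn)// invr_gt0.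
Unshelve. all: end_near. Qed.

End Limit.


Lemma measurable_inv (R : realType) : measurable_fun [set: R] (fun x : R => x^-1).
Proof.
have -> : (fun x : R => x^-1) = (fun x => if x == 0 then 0 else x^-1).
  by apply/funext => x; case: eqVneq => // ->; rewrite invr0.
apply: measurable_fun_if => //; first exact: measurable_fun_eqr.
rewrite setTI; apply: open_continuous_measurable_fun.
  have -> : (fun x : R => x == 0) @^-1` [set false] = ~` [set 0].
    by apply/seteqP; split => x /=; [move/eqP|move=> /eqP/negbTE].
  by apply: closed_openC; exact: closed_eq.
by move=> x; rewrite inE/= => /negbT x0; exact: inv_continuous.
Qed.

Lemma measurable_rate (R : realType) (H u w : R -> R) (D : set R) : measurable D ->
  measurable_fun D u -> measurable_fun D w ->
  measurable_fun D (fun t => 2^-1 * gmet H (u t) (w t) (w t) + DE (u t) (w t)).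
Proof.
move=> mD mu mw.
pose S (x : R) := if x == 1 then (kconst H)^-1
  else ln (x / (2 - x)) * (2 * kconst H * (x - 1))^-1.
have ml : measurable_fun [set: R] (fun x : R => ln (x / (2 - x))).
  apply: measurableT_comp; first exact: measurable_ln.
  apply: measurable_funM => //; apply: measurableT_comp; first exact: measurable_inv.
  exact: measurable_funB.
have mS : measurable_fun [set: R] S.
  apply: measurable_fun_ifT => //; first exact: measurable_fun_eqr.
  apply: measurable_funM => //; apply: measurableT_comp; first exact: measurable_inv.
  by apply: measurable_funM => //; exact: measurable_funB.
have -> : (fun t => 2^-1 * gmet H (u t) (w t) (w t) + DE (u t) (w t)) =
    (fun t => 2^-1 * (w t * w t * S (u t)) + 2^-1 * w t * ln (u t / (2 - u t))).
  by apply/funext => t; rewrite /gmet /DE /S; case: ifP => _ //; rewrite !mulrA.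
apply: measurable_funD.
  apply: measurable_funM => //; apply: measurable_funM; first exact: measurable_funM.
  exact: measurableT_comp mS mu.
by apply: measurable_funM; [exact: measurable_funM|exact: measurableT_comp ml mu].
Qed.

Theorem theorem4p1 (R : realType) (H : R -> R) (eps0 C c alpha T : R)
    (rho0 du0 : R -> R -> R) (rho : R -> R -> R -> R)
    (rho0lim : probability (measurableTypeR R) R)
    (e : nat -> R) (u du : R -> R)
    (HH : potential H)
    (eps0_gt0 : 0 < eps0)
    (H_int : forall eps, 0 < eps <= eps0 ->
       leb.-integrable [set: R] (EFin \o boltzmann H eps))
    (c_gt0 : 0 < c)
    (Hini : forall eps, 0 < eps <= eps0 ->
       initial_data H C c eps (rho0 eps) (du0 eps))
    (Hini_lim : forall phi, C0 phi ->
       \int[leb]_x (phi x * rho0 eps x) @[eps --> 0^'+]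
       --> \int[rho0lim]_x phi x)
    (Hsol : forall eps, 0 < eps <= eps0 ->
       solution H eps (rho0 eps) (du0 eps) (rho eps))
    (Hmax : exists2 m : R, 0 < m &
       forall eps t x, 0 < eps <= eps0 -> 0 <= t ->
         m <= densT H eps (rho eps) t x)
    (T_gt0 : 0 < T)
    (alpha01 : 0 < alpha < 1)
    (e_range : forall n, 0 < e n <= eps0)
    (e_lim : e n @[n --> \oo] --> 0)
    (Hu : H1 T u du)
    (Hlim : limit_of alpha T e rho u du)
    (Hbound : exists2 cs : R, 0 < cs < 2 &
       forall t, t \in `[0, T] -> cs <= u t <= 2 - cs)
    (v : R -> R) (Hv : L2 `[0, T] v) :
  (\int[leb]_(t in `[0%R, T])
     (2^-1 * gmet H (u t) (du t) (du t) + DE (u t) (du t))%:E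
   <= \int[leb]_(t in `[0%R, T])
     (2^-1 * gmet H (u t) (v t) (v t) + DE (u t) (v t))%:E)%E.
Proof.
have [u_cont _ [mdu _] _] := Hu.
have alpha0 : 0 < alpha by have /andP[] := alpha01.
have mD : measurable (`[0, T] : set (measurableTypeR R)) by exact: measurable_itv.
have mu : measurable_fun (`[0, T] : set (measurableTypeR R)) u.
  exact: subspace_continuous_measurable_fun.
pose w t := kconst H * (1 - u t).
have mw : measurable_fun (`[0, T] : set (measurableTypeR R)) w.
  by apply: measurable_funM => //; exact: measurable_funB.
have md : measurable_fun (`[0, T] : set (measurableTypeR R))
    (fun t => ((2^-1 * du t - 2^-1 * w t) ^+ 2)%:E).
  apply/measurable_EFinP; apply: measurable_funX.
  by apply: measurable_funB; exact: measurable_funM.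
have Z := limit_ode HH eps0_gt0 H_int Hini Hsol alpha0 e_range e_lim Hlim T_gt0 u_cont Hbound.
have ode : ae_eq leb (`[0, T] : set (measurableTypeR R)) du w.
  have : ae_eq leb (`[0, T] : set (measurableTypeR R))
      (fun t => ((2^-1 * du t - 2^-1 * w t) ^+ 2)%:E) (cst 0%E).
    apply/(ae_eq_integral_abs leb mD md).
    under eq_integral do rewrite abse_EFin ger0_norm ?sqr_ge0//.
    rewrite -integral_itv_obnd_cbnd//.
    by apply: measurable_funS md => //; exact: subset_itv_oc_cc.
  apply: filterS => t /= h tD; move: (h tD) => [] /eqP.
  by rewrite sqrf_eq0 -mulrBr mulf_eq0 invr_eq0 pnatr_eq0/= subr_eq0 => /eqP.
rewrite (@ae_eq_integral _ _ _ leb _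
  (fun t => (2^-1 * gmet H (u t) (w t) (w t) + DE (u t) (w t))%:E)) //.
- apply: le_integral_nomeas => t tD; rewrite lee_fin; apply: minimal_rate => //.
  have [cs /andP[cs0 cs2] hu] := Hbound.
  have /andP[? ?] := hu t (mem_set tD); apply/andP; split; lra.
- by apply/measurable_EFinP; exact: measurable_rate.
- by apply/measurable_EFinP; exact: measurable_rate.
- by apply: filterS ode => t h tD; rewrite (h tD).
Qed.
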